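(* Let $\mathcal{C}$ be a nowhere dense class of graphs, let $d$ be a positive integer, and let $\varepsilon$ be a positive real. Then there is an integer $k_0$ such that for every graph $G$ in $\mathcal{C}$ and all vertex subsets $A, B \subseteq V(G)$ satisfying $|A\cup B|\geq k_0$, there exist disjoint sets $A'\subseteq A$ and $B'\subseteq B$ such that $$|A'| \ge (1-\varepsilon)\cdot |A|,\qquad |B'| \ge \frac{|B|}{|A \cup B|^{\varepsilon}},$$ and in $G^d$ every vertex from $A'$ is adjacent either to all vertices from $B'$ or to no vertex from $B'$.
   Context: All graphs are finite, simple and undirected. The radius of a connected graph $H$ is the least integer $r$ for which some vertex of $H$ is at distance at most $r$ from every vertex of $H$. For a partition $\mathcal{X}$ of $V(G)$ into nonempty parts inducing connected subgraphs, $G/\mathcal{X}$ is the graph with vertex set $\mathcal{X}$ in which two distinct parts $X,Y$ are adjacent if $G$ has an edge with one endpoint in $X$ and the other in $Y$. A graph $H$ is a depth-$r$ minor of $G$ if $H$ is isomorphic to a subgraph of $G/\mathcal{X}$ for some partition $\mathcal{X}$ of $V(G)$ into nonempty parts inducing connected subgraphs of radius at most $r$. A class of graphs $\mathcal{C}$ is nowhere dense if for each integer $r\geq 0$ there exists a graph which is not a depth-$r$ minor of any graph from $\mathcal{C}$. The $d$-th power $G^d$ of a graph $G$ is the graph on vertex set $V(G)$ in which two distinct vertices are adjacent if and only if their distance in $G$ is at most $d$. *)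

(* Defs.v *)
From HB Require Import structures.
From mathcomp Require Import all_boot.

Set Implicit Arguments.
Unset Strict Implicit.
Unset Printing Implicit Defensive.

Record sgraph := SGraph {
  vertex :> finType;
  adj : rel vertex;
  adj_sym : symmetric adj;
  adj_irrefl : irreflexive adj }.

Definition graph_class := sgraph -> Prop.

(* [n.-bseq G] is the finite type of sequences of at most [n] vertices, so this
   asks for a walk from [x] to [y] with at most [n] edges; it is false for every
   [n] when [x] and [y] lie in different components. *)
Definition dist_le (G : sgraph) (n : nat) (x y : G) : bool :=
  [exists p : n.-bseq G, path (@adj G) x p && (last x p == y)].

Lemma dist_leP (G : sgraph) (n : nat) (x y : G) :
  reflect (exists p : seq G,
             [/\ path (@adj G) x p, last x p = y & size p <= n])
          (dist_le n x y).
Proof.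
apply: (iffP existsP) => [[p /andP[px /eqP lx]]|[p [px lx sp]]].
  by exists p; split=> //; exact: size_bseq.
by exists (Bseq sp); rewrite /= px lx eqxx.
Qed.

Lemma dist_le_sym (G : sgraph) (n : nat) : symmetric (@dist_le G n).
Proof.
suff imp x y : @dist_le G n x y -> dist_le n y x.
  by move=> x y; apply/idP/idP; exact: imp.
move=> /dist_leP[p [px <- sp]]; apply/dist_leP.
exists (rev (belast x p)); split; last by rewrite size_rev size_belast.
  by rewrite rev_path (eq_path (e' := @adj G)) // => u v; exact: adj_sym.
by case: p {px sp} => //= z p; rewrite rev_cons last_rcons.
Qed.

Definition connected (H : sgraph) : Prop :=
  forall x y : H, connect (@adj H) x y.

Definition covered_within (H : sgraph) (r : nat) : Prop :=
  exists c : H, forall v : H, dist_le r c v.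

Definition is_radius (H : sgraph) (r : nat) : Prop :=
  covered_within H r /\ forall s : nat, covered_within H s -> r <= s.

Definition radius_le (H : sgraph) (r : nat) : Prop :=
  exists2 s : nat, is_radius H s & s <= r.

Section Induced.
Variables (G : sgraph) (X : {set G}).

Definition induced_adj : rel {x : G | x \in X} :=
  fun x y => adj (val x) (val y).

Fact induced_adj_sym : symmetric induced_adj.
Proof. by move=> x y; exact: adj_sym. Qed.

Fact induced_adj_irrefl : irreflexive induced_adj.
Proof. by move=> x; exact: adj_irrefl. Qed.

Definition induced : sgraph := SGraph induced_adj_sym induced_adj_irrefl.

End Induced.

Section Quotient.
Variables (G : sgraph) (P : {set {set G}}).

Definition quotient_adj : rel {X : {set G} | X \in P} :=
  fun X Y =>
    (X != Y) && [exists x in val X, [exists y in val Y, adj x y]].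

Fact quotient_adj_sym : symmetric quotient_adj.
Proof.
suff imp X Y : quotient_adj X Y -> quotient_adj Y X.
  by move=> X Y; apply/idP/idP; exact: imp.
case/andP=> neqXY /existsP[x /andP[xX /existsP[y /andP[yY xy]]]].
rewrite /quotient_adj eq_sym neqXY; apply/existsP; exists y.
by rewrite yY; apply/existsP; exists x; rewrite xX adj_sym.
Qed.

Fact quotient_adj_irrefl : irreflexive quotient_adj.
Proof. by move=> X; rewrite /quotient_adj eqxx. Qed.

Definition quotient_graph : sgraph :=
  SGraph quotient_adj_sym quotient_adj_irrefl.

End Quotient.

Section Power.
Variables (G : sgraph) (d : nat).

Definition power_adj : rel G := fun x y => (x != y) && dist_le d x y.

Fact power_adj_sym : symmetric power_adj.
Proof. by move=> x y; rewrite /power_adj eq_sym dist_le_sym. Qed.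

Fact power_adj_irrefl : irreflexive power_adj.
Proof. by move=> x; rewrite /power_adj eqxx. Qed.

Definition power_graph : sgraph := SGraph power_adj_sym power_adj_irrefl.

End Power.

(* The subgraph need not be induced, so edges of [H] must be preserved but not
   reflected. *)
Definition isomorphic_to_subgraph (H K : sgraph) : Prop :=
  exists2 f : H -> K, injective f & forall x y : H, adj x y -> adj (f x) (f y).

(* [partition P setT] includes that every part is nonempty. *)
Definition depth_minor (r : nat) (H G : sgraph) : Prop :=
  exists P : {set {set G}},
    [/\ partition P [set: G],
        forall X : {set G}, X \in P ->
          connected (induced X) /\ radius_le (induced X) r
      & isomorphic_to_subgraph H (quotient_graph P)].

Definition nowhere_dense (C : graph_class) : Prop :=
  forall r : nat, exists H : sgraph,
    forall G : sgraph, C G -> ~ depth_minor r H G.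

(* Main.v *)
Require Import Defs.
From mathcomp Require Import all_boot all_order all_algebra.
From mathcomp Require Import reals exp.
From mathcomp Require Import zify.

Set Implicit Arguments.
Unset Strict Implicit.
Unset Printing Implicit Defensive.

(* Let k = |A u B| and let mu be a small power of k.  Every shallow minor with at most
   poly(k) vertices has average degree at most mu: otherwise contracting it repeatedly
   onto small sets that dominate most vertices many times keeps the density while
   shrinking the order, until a large clique minor of bounded depth appears.

   Using this, we maintain a large family of equal-sized subsets of B whose i-balls, in G
   minus a bounded set S, lie in disjoint connected sets of bounded radius, and
   increase i up to d.  To pass from i to i+1, sparsity lets us keep a 1/poly(mu)
   fraction of the pieces and group them into clusters around single vertices so that
   different clusters have disjoint closed neighbourhoods.  If one cluster contains a
   large share of the pieces, its centre is moved to S; this happens a bounded number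
   of times, because t such hubs with t common neighbouring pieces give a clique minor.
   Otherwise the clusters are merged into new pieces.

   At the end keep only vertices of B with the most frequent distance profile to S, and
   choose few enough pieces that they cover at most an epsilon fraction of A; the rest
   of A sees the chosen part of B only through S, hence homogeneously. *)

(** * Counting in finite sets: unions, fibres, pigeonhole *)

Lemma leq_card_bigcup_sum (I A : finType) (K : {set I}) (F : I -> {set A}) :
  #|\bigcup_(i in K) F i| <= \sum_(i in K) #|F i|.
Proof.
elim/big_rec2: _ => [|i y s _ IH]; first by rewrite cards0.
by apply: leq_trans (leq_card_setU _ _) _; rewrite leq_add2l.
Qed.

Lemma leq_card_bigcup (I A : finType) (X : {set I}) (F : I -> {set A}) m :
  {in X, forall i, #|F i| <= m} -> #|\bigcup_(i in X) F i| <= m * #|X|.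
Proof.
move=> Fm; apply: leq_trans (leq_card_bigcup_sum X F) _.
by rewrite mulnC -sum_nat_const; apply: leq_sum.
Qed.

Lemma sum_card_disjoint (I A : finType) (K : {set I}) (P : I -> {set A}) :
  {in K &, forall i j, i != j -> [disjoint P i & P j]} ->
  \sum_(i in K) #|P i| <= #|\bigcup_(i in K) P i|.
Proof.
move=> dP; pose D := [set q : I * A | (q.1 \in K) && (q.2 \in P q.1)].
have -> : \sum_(i in K) #|P i| = #|D|.
  under eq_bigr do rewrite -sum1_card.
  by rewrite pair_big_dep -sum1_card; apply: eq_bigl => q; rewrite inE.
have injD : {in D &, injective snd}.
  move=> [i x] [j y]; rewrite !inE /= => /andP[iK xi] /andP[jK yj] xy.
  rewrite -{}xy in yj *; have [->//|ij] := eqVneq i j.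
  by have /pred0P/(_ x) := dP i j iK jK ij; rewrite /= xi yj.
rewrite -(card_in_imset injD); apply/subset_leq_card/subsetP => x.
case/imsetP => -[i y]; rewrite inE /= => /andP[iK yi] ->.
by apply/bigcupP; exists i.
Qed.

Lemma sum_fibres (I A : finType) (K : {set I}) (z : I -> A) (Z : {set A}) :
  \sum_(x in Z) #|[set i in K | z i == x]| = #|[set i in K | z i \in Z]|.
Proof.
under eq_bigr do rewrite -sum1dep_card.
rewrite -sum1dep_card (partition_big z (mem Z)) /=; last by move=> i /andP[].
apply: eq_bigr => x xZ; apply: eq_bigl => i.
by have [->|] := eqVneq (z i) x; rewrite ?xZ ?andbT ?andbF.
Qed.

Lemma pigeonhole (A X : finType) (f : A -> X) (B : {set A}) (W : {set X}) :
  {in B, forall b, f b \in W} -> B != set0 ->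
  exists w, #|B| <= #|W| * #|[set b in B | f b == w]|.
Proof.
move=> fW /set0Pn[b0 b0B].
have [w wW wmax] := arg_maxnP (fun w => #|[set b in B | f b == w]|) (fW b0 b0B).
exists w; apply: leq_trans (_ : \sum_(v in W) #|[set b in B | f b == v]| <= _).
  rewrite sum_fibres; apply/subset_leq_card/subsetP => b bB.
  by rewrite inE bB fW.
by rewrite -sum_nat_const; apply: leq_sum.
Qed.

Lemma subset_of_card (A : finType) (X : {set A}) n : n <= #|X| ->
  exists2 Y : {set A}, Y \subset X & #|Y| = n.
Proof.
move=> le; exists [set x in take n (enum X)].
  by apply/subsetP => x; rewrite inE => /mem_take; rewrite mem_enum.
rewrite cardsE; move/card_uniqP: (take_uniq n (enum_uniq (mem X))) => ->.
by rewrite size_take_min -cardE; apply/minn_idPl.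
Qed.

(** * Hereditarily sparse relations: colouring, independent sets, weighted selection *)

Section Combinatorics.
Variable I : finType.
Implicit Types (f g : rel I) (J K : {set I}) (w : I -> nat).

(** Ordered pairs are counted, so this is a degree sum, twice the number of edges of a simple graph;
    [hsparse] accordingly bounds the average degree of every induced subgraph. *)
Definition edges f K := \sum_(i in K) #|[set j in K | f i j]|.

Definition hsparse f J c := forall K, K \subset J -> edges f K <= c * #|K|.

Lemma leq_edges f g K :
  {in K &, forall i j, f i j -> g i j} -> edges f K <= edges g K.
Proof.
move=> fg; apply: leq_sum => i iK; apply/subset_leq_card/subsetP => j.
by rewrite !inE => /andP[jK fij]; rewrite jK fg.
Qed.

Lemma edgesE f K : edges f K = #|[set p in setX K K | f p.1 p.2]|.
Proof.
rewrite /edges -sum1_card; under eq_bigr do rewrite -sum1_card.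
rewrite pair_big_dep /=; apply: eq_bigl => -[i j] /=.
by rewrite !inE /= andbA.
Qed.

Lemma hsparseS f J K c : K \subset J -> hsparse f J c -> hsparse f K c.
Proof. by move=> sKJ sp L sLK; apply: sp; apply: subset_trans sKJ. Qed.

Lemma hsparse_low f J c : hsparse f J c -> J != set0 ->
  exists2 i, i \in J & #|[set j in J | f i j]| <= c.
Proof.
move=> sp J0; have [/exists_inP[i iJ ?]|/exists_inPn far] :=
  boolP [exists i in J, #|[set j in J | f i j]| <= c]; first by exists i.
have := sp J (subxx _); rewrite leqNgt => /negP[].
rewrite /edges mulnC -sum_nat_const; case/set0Pn: J0 => i0 i0J.
rewrite (bigD1 i0) // [X in _ < X](bigD1 i0) //= -addSn leq_add //.
  by have := far _ i0J; lia.
by apply: leq_sum => i /andP[iJ _]; have := far _ iJ; lia.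
Qed.

(** Greedy colouring: a vertex of degree at most [c] is set aside, the rest is coloured by
    induction, and its neighbours leave one of [c.+1] colours free. *)
Lemma colouring f J c : symmetric f -> irreflexive f -> hsparse f J c ->
  exists col : I -> 'I_c.+1, {in J &, forall i j, f i j -> col i != col j}.
Proof.
move=> fs fi; have [n] := ubnP #|J|; elim: n J => // n IH J ltJn sp.
have [->|J0] := eqVneq J set0.
  by exists (fun=> ord0) => i j; rewrite inE.
have [i iJ low] := hsparse_low sp J0.
have [|col colP] := IH (J :\ i) _ (hsparseS (subsetDl _ _) sp).
  by rewrite (cardsD1 i J) iJ in ltJn.
have [a aP] : exists a, a \notin [set col j | j in [set j in J | f i j]].
  apply/existsP; rewrite -negb_forall; apply/negP => /forallP all_in.
  suff: c.+1 <= c by rewrite ltnn.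
  rewrite -[X in X <= _]card_ord; apply: leq_trans low.
  apply: leq_trans (leq_imset_card col _).
  by apply/subset_leq_card/subsetP => x _; exact: all_in.
exists (fun j => if j == i then a else col j) => j k jJ kJ fjk.
have [ji|ji] := eqVneq j i; have [ki|ki] := eqVneq k i.
- by move: fjk; rewrite ji ki fi.
- apply: contraNneq aP => ->; apply/imsetP; exists k; rewrite // inE kJ.
  by rewrite -ji.
- apply: contraNneq aP => <-; apply/imsetP; exists j; rewrite // inE jJ.
  by rewrite -ki fs.
- by apply: colP; rewrite // !inE ?ji ?ki ?jJ ?kJ.
Qed.

(** The vertex of degree at most [c] that is removed first receives the top rank [M], so all its
    neighbours may precede it; induction ranks the rest. *)
Lemma degenerate_rank f J c : symmetric f -> hsparse f J c ->
  exists2 rk : I -> nat, {in J &, injective rk} &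
    {in J, forall i, #|[set j in J | f i j && (rk j < rk i)]| <= c}.
Proof.
move=> fs; have [n] := ubnP #|J|; elim: n J => // n IH J ltJn sp.
have [->|J0] := eqVneq J set0.
  by exists (fun=> 0) => [i j|i]; rewrite inE.
have [i iJ low] := hsparse_low sp J0.
have [|rk rkI rkP] := IH (J :\ i) _ (hsparseS (subsetDl _ _) sp).
  by rewrite (cardsD1 i J) iJ in ltJn.
pose M := (\max_(j in J) rk j).+1.
have ltM j : j \in J -> rk j < M by move=> jJ; rewrite ltnS leq_bigmax_cond.
exists (fun j => if j == i then M else rk j) => [j k jJ kJ /=|j jJ /=].
  have [->|ji] := eqVneq j i; have [->|ki] := eqVneq k i => //.
  - by move=> E; have := ltM _ kJ; rewrite -E ltnn.
  - by move=> E; have := ltM _ jJ; rewrite -E ltnn.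
  - by move=> E; apply: rkI; rewrite // !inE ?ji ?ki ?jJ ?kJ.
have [->|ji] := eqVneq j i.
  apply: leq_trans low; apply/subset_leq_card/subsetP => k.
  by rewrite !inE => /andP[-> /andP[-> _]].
apply: leq_trans (rkP j _); last by rewrite !inE ji.
apply/subset_leq_card/subsetP => k; rewrite !inE => /andP[kJ /andP[fjk]].
rewrite kJ fjk andbT; have [->|ki] := eqVneq k i; last by [].
by rewrite ltnNge ltnW ?ltM.
Qed.

Lemma pigeonhole_sum (L : nat) (col : I -> 'I_L.+1) J w :
  exists a, \sum_(i in J) w i <= L.+1 * \sum_(i in J | col i == a) w i.
Proof.
pose S a := \sum_(i in J | col i == a) w i.
pose a := [arg max_(a > ord0) S a]; exists a.
have aP b : S b <= S a by rewrite /a; case: arg_maxnP => // c _; exact.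
rewrite (partition_big col predT) //=.
apply: leq_trans (_ : \sum_(b : 'I_L.+1) S a <= _); last first.
  by rewrite sum_nat_const card_ord.
by apply: leq_sum => b _; exact: aP.
Qed.

(** The heaviest class of a [c.+1]-colouring works. Weights are needed because a vertex will stand
    for the whole cluster of pieces grouped at it. *)
Lemma indep_weight f J c w : symmetric f -> irreflexive f -> hsparse f J c ->
  exists K, [/\ K \subset J, {in K &, forall i j, ~~ f i j} &
    \sum_(i in J) w i <= c.+1 * \sum_(i in K) w i].
Proof.
move=> fs fi /(colouring fs fi)[col colP].
have [a aP] := pigeonhole_sum col J w.
exists [set i in J | col i == a]; split.
- by apply/subsetP => i; rewrite inE => /andP[].
- move=> i j; rewrite !inE => /andP[iJ /eqP ia] /andP[jJ /eqP ja].
  by apply/negP => /(colP _ _ iJ jJ); rewrite ia ja eqxx.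
- by under [X in _ * X]eq_bigl do rewrite inE.
Qed.

Lemma indep_card f J c : symmetric f -> irreflexive f -> hsparse f J c ->
  exists K, [/\ K \subset J, {in K &, forall i j, ~~ f i j} &
    #|J| <= c.+1 * #|K|].
Proof.
move=> fs fi /(indep_weight (fun=> 1) fs fi)[K [sKJ ind]].
by rewrite !sum1_card => le; exists K.
Qed.

(** Indices are sorted by the integer part of the binary logarithm of [w i]; taking the heaviest
    class costs [L.+1], and rounding its weights down to a power of two costs 2. *)
Lemma dyadic J w L : {in J, forall i, 0 < w i < 2 ^ L.+1} ->
  exists K s, [/\ K \subset J, 0 < s, {in K, forall i, s <= w i} &
    \sum_(i in J) w i <= L.+1 * (2 * (s * #|K|))].
Proof.
move=> wP; pose col i : 'I_L.+1 := inord (trunc_log 2 (w i)).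
have colE i : i \in J -> col i = trunc_log 2 (w i) :> nat.
  move=> /wP /andP[w0 wL]; rewrite inordK // -(ltn_exp2l _ _ (isT : 1 < 2)).
  by apply: leq_ltn_trans wL; apply: trunc_logP.
have [a aP] := pigeonhole_sum col J w.
exists [set i in J | col i == a], (2 ^ a); split.
- by apply/subsetP => i; rewrite inE => /andP[].
- by rewrite expn_gt0.
- move=> i; rewrite inE => /andP[iJ /eqP <-]; rewrite colE //.
  by apply: trunc_logP => //; case/andP: (wP i iJ).
- apply: leq_trans aP _; rewrite leq_mul2l /=.
  rewrite [X in _ <= _ * X]mulnC mulnCA -[X in _ <= X]sum_nat_const.
  under [X in _ <= X]eq_bigl do rewrite inE.
  apply: leq_sum => i /andP[iJ /eqP <-]; rewrite colE // -expnS.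
  by apply/ltnW/trunc_log_ltn.
Qed.

(* Subsets of [b]-weight between [v] and [2 * v] are peeled off until one of them carries at most
   a [1/c] share of the [a]-mass. *)
Lemma light_subset J (b a : I -> nat) v c : 0 < v -> 0 < c ->
  {in J, forall i, b i <= v} -> 2 * v * c <= \sum_(i in J) b i ->
  exists2 K : {set I}, K \subset J & v <= \sum_(i in K) b i /\
    c * \sum_(i in K) a i <= \sum_(i in J) a i.
Proof.
move=> v0; elim: c J => // c IH J _ bv big.
(* Indices are dropped one at a time; each drop costs at most [v], so the weight cannot jump from
   above [2 * v] to below [v]. *)
have [K sKJ /andP[vK Kv]] : exists2 K : {set I}, K \subset J &
    v <= \sum_(i in K) b i <= 2 * v.
  have vJ : v <= \sum_(i in J) b i by nia.
  have [n] := ubnP #|J|; elim: n J bv vJ {IH big} => // n IHn J bv vJ ltn.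
  have [le|gt] := leqP (\sum_(i in J) b i) (2 * v); first by exists J; rewrite ?vJ.
  have [J0|[j jJ]] := set_0Vmem J; first by move: gt; rewrite J0 big_set0.
  have E : \sum_(i in J) b i = b j + \sum_(i in J :\ j) b i.
    by rewrite (bigD1 j) //; congr (_ + _); apply: eq_bigl => i; rewrite !inE andbC.
  have [|||K sK P] := IHn (J :\ j).
  - by move=> i /setD1P[_]; exact: bv.
  - by have := bv _ jJ; lia.
  - by rewrite (cardsD1 j J) jJ in ltn.
  by exists K => //; apply: subset_trans sK (subsetDl _ _).
have split_sum (g : I -> nat) : \sum_(i in J) g i = \sum_(i in K) g i + \sum_(i in J :\: K) g i.
  rewrite (big_setID K) /=; congr (_ + _); by rewrite (setIidPr sKJ).
(* If [K] holds more than a [1 / c.+1] share of the [a]-mass, the rest holds less than [c / c.+1] of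
   it, and a [1 / c] share of the rest is small enough. *)
have [le|gt] := leqP (c.+1 * \sum_(i in K) a i) (\sum_(i in J) a i).
  by exists K.
case: c IH big gt => [|c] IH big gt; first by rewrite (split_sum a) in gt; lia.
have [i /setDP[iJ _]||K' sK' [vK' aK']] := IH (J :\: K) isT.
- exact: bv.
- by rewrite (split_sum b) in big; nia.
exists K'; first exact: subset_trans sK' (subsetDl _ _).
split=> //; rewrite (split_sum a) in gt *; nia.
Qed.

End Combinatorics.

(** * Packing connectors between pairs of indices *)

Section Packing.
Variables (I Y : finType) (inc : Y -> I -> bool) (K : {set I}).

(* A maximal set [X] of connectors receiving distinct pairs of incident indices;
   [H] is the graph of the pairs used and [al y] the end that absorbs [y]. *)
Lemma packing (Y0 : {set Y}) : (exists i0 : I, i0 \in K) ->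
  exists (X : {set Y}) (al : Y -> I) (H : rel I),
  [/\ X \subset Y0, symmetric H, irreflexive H,
      {in X, forall y, al y \in K /\ inc y (al y)} &
  [/\ forall i j, H i j -> exists2 y, y \in X &
        (al y = i /\ inc y j) \/ (al y = j /\ inc y i),
      #|X| <= edges H K &
      forall y, y \in Y0 -> y \notin X -> {in K &, forall i j,
        i != j -> inc y i -> inc y j -> H i j}]].
Proof.
case=> i0 i0K; have [n] := ubnP #|Y0|; elim: n Y0 => // n IH Y0 ltn.
have [->|[y0 y0Y]] := set_0Vmem Y0.
  exists set0, (fun=> i0), (fun _ _ => false).
  by split=> //; [move=> y|split=> //; [rewrite cards0|move=> y]]; rewrite ?inE.
have [|X [al [H [sXY Hs Hi alK [Hw cX Hc]]]]] := IH (Y0 :\ y0).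
  by rewrite (cardsD1 y0) y0Y in ltn.
have y0X : y0 \notin X by apply/negP => /(subsetP sXY); rewrite !inE eqxx.
have sXY0 : X \subset Y0 := subset_trans sXY (subsetDl _ _).
have [/existsP[[i j] /= /and5P[/andP[iK jK] ij ii ij' nH]]|none] := boolP
  [exists p : I * I, [&& (p.1 \in K) && (p.2 \in K), p.1 != p.2, inc y0 p.1,
     inc y0 p.2 & ~~ H p.1 p.2]]; last first.
  exists X, al, H; split=> //; split=> // y yY yX i j iK jK ij yi yj.
  have [yy|yy] := eqVneq y y0; last by apply: (Hc y) => //; rewrite !inE yy.
  apply: contraNT none => nH; apply/existsP; exists (i, j).
  by rewrite /= -yy iK jK ij yi yj.
pose H' a b := H a b || ((a, b) == (i, j)) || ((a, b) == (j, i)).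
exists (y0 |: X), (fun y => if y == y0 then i else al y), H'; split.
- by apply/subsetP => y /setU1P[->//|/(subsetP sXY0)].
- move=> a b; rewrite /H' Hs -!orbA; congr (_ || _).
  by rewrite orbC !xpair_eqE; congr (_ || _); rewrite andbC.
- move=> a; rewrite /H' Hi !xpair_eqE /=; apply/negP => /orP[] /andP[/eqP-> /eqP E].
    by rewrite E eqxx in ij.
  by rewrite E eqxx in ij.
- move=> y /setU1P[->|yX]; first by rewrite eqxx.
  by rewrite ifN; [exact: alK|apply: contraNneq y0X => <-].
split.
- move=> a b; rewrite /H' -orbA => /orP[/Hw[y yX P]|].
    exists y; first by rewrite inE yX orbT.
    by rewrite ifN; [|apply: contraNneq y0X => <-].
  by case/orP => /eqP[-> ->]; exists y0; rewrite ?setU11 ?eqxx //; [left|right].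
- rewrite cardsU1 y0X add1n; apply: leq_ltn_trans cX _; rewrite !edgesE.
  apply: proper_card; apply/properP; split.
    by apply/subsetP => -[a b]; rewrite !inE /= /H' => /andP[-> ->].
  by exists (i, j); rewrite !inE /= iK jK /H' ?eqxx ?orbT //=.
- move=> y yY; rewrite !inE negb_or => /andP[yy yX] a b aK bK ab ya yb.
  by rewrite /H' (Hc y) // !inE yy.
Qed.
End Packing.

(** * Neighbourhoods, balls and connected sets of bounded radius *)

Section Balls.
Variable T : finType.
Implicit Types (e f : rel T) (X Y W : {set T}).

Definition nb e X := X :|: [set y | [exists x in X, e x y]].

Definition ball e n X := iter n (nb e) X.

Definition within e X : rel T := fun x y => [&& e x y, x \in X & y \in X].

Definition touch e X Y := [exists x in X, [exists y in Y, e x y]].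

(** Distances are measured inside [X], so for symmetric [e] this includes connectedness of the
    subgraph induced by [X]. *)
Definition rad e r X :=
  exists2 c, c \in X & X \subset ball (within e X) r [set c].

Lemma nbP e X y : reflect (y \in X \/ exists2 x, x \in X & e x y) (y \in nb e X).
Proof.
by rewrite !inE; apply: (iffP orP) => [] [?|/exists_inP ?]; by [left|right].
Qed.

Lemma touchP e X Y :
  reflect (exists x y, [/\ x \in X, y \in Y & e x y]) (touch e X Y).
Proof.
apply: (iffP exists_inP) => [[x xX /exists_inP[y yY exy]]|[x [y [xX yY exy]]]].
  by exists x, y.
by exists x => //; apply/exists_inP; exists y.
Qed.

Lemma touchS e f X Y X' Y' : subrel e f -> X \subset X' -> Y \subset Y' ->
  touch e X Y -> touch f X' Y'.
Proof.
move=> ef /subsetP sX /subsetP sY /touchP[x [y [/sX ? /sY ? /ef ?]]].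
by apply/touchP; exists x, y.
Qed.

Lemma touch_sym e X Y : symmetric e -> touch e X Y = touch e Y X.
Proof.
by move=> es; apply/touchP/touchP => -[x [y [xX yY exy]]]; exists y, x; rewrite es.
Qed.

Lemma sub_nb e X : X \subset nb e X. Proof. exact: subsetUl. Qed.

Lemma nbS e f X Y : subrel e f -> X \subset Y -> nb e X \subset nb f Y.
Proof.
move=> ef /subsetP sXY; apply/subsetP => y /nbP[/sXY yY|[x /sXY xY /ef exy]].
  by apply/nbP; left.
by apply/nbP; right; exists x.
Qed.

Lemma ballS e f m n X Y : subrel e f -> m <= n -> X \subset Y ->
  ball e m X \subset ball f n Y.
Proof.
move=> ef /subnK <- sXY; rewrite /ball iterD.
have: ball e m X \subset ball f m Y by elim: m => //= m IH; exact: nbS.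
move: (n - m) => k le; apply: subset_trans le _.
by elim: k => //= k IH; apply: subset_trans IH (sub_nb _ _).
Qed.

Lemma sub_ball e n X : X \subset ball e n X.
Proof. exact: (@ballS e e 0 n). Qed.

Lemma ballP e n X y :
  reflect (exists2 x, x \in X & y \in ball e n [set x]) (y \in ball e n X).
Proof.
apply: (iffP idP) => [|[x xX]]; last first.
  by apply/subsetP/ballS; rewrite ?sub1set.
elim: n y => [y yX|n IH y /nbP[/IH[x xX yx]|[z /IH[x xX zx] ezy]]].
- by exists y; rewrite ?inE.
- by exists x => //; apply/nbP; left.
- by exists x => //; apply/nbP; right; exists z.
Qed.

Lemma ballD e m n X : ball e (m + n) X = ball e m (ball e n X).
Proof. by rewrite /ball iterD. Qed.

Lemma ball_trans e m n X x y : x \in ball e m X -> y \in ball e n [set x] ->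
  y \in ball e (n + m) X.
Proof. by rewrite ballD => xX yx; apply/ballP; exists x. Qed.

Lemma ball1_edge e x y : e x y -> y \in ball e 1 [set x].
Proof. by move=> exy; apply/nbP; right; exists x; rewrite ?inE. Qed.

Lemma ball_sym e n x y : symmetric e ->
  (y \in ball e n [set x]) = (x \in ball e n [set y]).
Proof.
move=> es; suff imp a b : b \in ball e n [set a] -> a \in ball e n [set b].
  by apply/idP/idP; exact: imp.
elim: n a b => [a b|n IH a b]; first by rewrite !inE eq_sym.
case/nbP => [/IH|[z /IH az ezb]]; first by apply/subsetP/ballS.
by rewrite -addn1; apply: ball_trans az; apply: ball1_edge; rewrite es.
Qed.

Lemma within_sym e X : symmetric e -> symmetric (within e X).
Proof. by move=> es x y; rewrite /within es [(x \in X) && _]andbC. Qed.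

Lemma withinS e f X Y : subrel e f -> X \subset Y ->
  subrel (within e X) (within f Y).
Proof.
move=> ef /subsetP sXY x y /and3P[/ef exy /sXY xY /sXY yY].
by rewrite /within exy xY.
Qed.

Lemma radS e f m n X : subrel e f -> m <= n -> rad e m X -> rad f n X.
Proof.
move=> ef le_mn [c cX sub]; exists c => //; apply: subset_trans sub _.
by apply: ballS => //; exact: withinS.
Qed.

Lemma rad1 e x : rad e 0 [set x].
Proof. by exists x; rewrite ?inE. Qed.

Lemma rad_from e r X x y : symmetric e -> rad e r X -> x \in X -> y \in X ->
  y \in ball (within e X) (2 * r) [set x].
Proof.
move=> es [c cX /subsetP sub] xX yX; rewrite mul2n -addnn.
by apply: (ball_trans (x := c)); [rewrite ball_sym ?sub //; exact: within_sym|exact: sub].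
Qed.

(** From the centre of [X]: [r] steps to the touching edge, one step across it, and [2 * r'] steps
    inside [Z i]. *)
Lemma rad_union e r r' X (I : finType) (P : {set I}) (Z : I -> {set T}) :
  symmetric e -> rad e r X ->
  {in P, forall i, rad e r' (Z i) /\ touch e X (Z i)} ->
  rad e (r + (2 * r').+1) (X :|: \bigcup_(i in P) Z i).
Proof.
move=> es [c cX sX] ZP; set W := X :|: _; exists c; first by rewrite inE cX.
have sXW : X \subset W by apply: subsetUl.
apply/subsetP => y /setUP[yX|/bigcupP[i iP yi]].
  have /(subsetP sX) := yX; apply/subsetP; apply: ballS => //; last exact: leq_addr.
  exact: withinS.
have [ri /touchP[x [z [xX zi exz]]]] := ZP _ iP.
have siW : Z i \subset W by rewrite subsetU // (bigcup_sup i) ?orbT.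
rewrite -addn1 addnC -addnA; apply: (ball_trans (x := z)); last first.
  have := rad_from es ri zi yi; apply/subsetP; apply: ballS => //.
  exact: withinS.
apply: (ball_trans (x := x)); last first.
  by apply: ball1_edge; rewrite /within exz (subsetP sXW) ?(subsetP siW).
have /(subsetP sX) := xX; apply/subsetP; apply: ballS => //; exact: withinS.
Qed.

(** With [z] as centre: at most one step into [Z i], [2 * r] steps inside it, and one step out to
    its neighbourhood. *)
Lemma rad_star e r z (I : finType) (P : {set I}) (Z : I -> {set T}) :
  symmetric e -> (exists i, i \in P) ->
  {in P, forall i, rad e r (Z i) /\ z \in nb e (Z i)} ->
  rad e (2 * r).+2 (\bigcup_(i in P) nb e (Z i)).
Proof.
move=> es [i0 i0P] ZP; set W := \bigcup_(i in P) _.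
have sW i : i \in P -> nb e (Z i) \subset W by move=> iP; apply: (bigcup_sup i).
have sZ i : i \in P -> Z i \subset W.
  by move=> iP; apply: subset_trans (sW i iP); apply: sub_nb.
have step i x y : i \in P -> x \in Z i -> y \in nb e (Z i) -> 
    exists2 x', x' \in Z i & y \in ball (within e W) 1 [set x'].
  move=> iP xi /nbP[yi|[x' x'i ey]]; first by exists y; rewrite // (subsetP (sub_ball _ _ _)) ?inE.
  exists x' => //; apply: ball1_edge; rewrite /within ey (subsetP (sZ i iP)) //=.
  by apply: (subsetP (sW i iP)); apply/nbP; right; exists x'.
exists z; first by have [_] := ZP _ i0P; apply/subsetP/sW.
apply/subsetP => y /bigcupP[i iP yi]; have [ri zi] := ZP _ iP.
have [c ci _] := ri.
have [a ai az] := step i c z iP ci zi; have [b bi by_] := step i c y iP ci yi.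
rewrite -[_.+2]/(1 + (1 + 2 * r)) [1 + 2 * r]addnC.
apply: (ball_trans (x := b)) => //; apply: (ball_trans (x := a)).
  by rewrite ball_sym //; exact: within_sym.
have := rad_from es ri ai bi; apply/subsetP; apply: ballS => //.
by apply: withinS => //; exact: sZ.
Qed.

End Balls.

(** * Shallow minors as families of disjoint sets *)

Section Families.
Variable T : finType.
Implicit Types (e f : rel T).

(** The branch sets of a depth-[r] minor; [near] is the adjacency of that minor, [clique_free]
    excludes the complete graph on [t] vertices, and [sparse] bounds the average degree of minors of
    order at most [N]. *)
Definition family e r (I : finType) (J : {set I}) (Q : I -> {set T}) :=
  {in J, forall i, rad e r (Q i)} /\
  {in J &, forall i j, i != j -> [disjoint Q i & Q j]}.

Definition near e (I : finType) (Q : I -> {set T}) : rel I :=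
  fun i j => (i != j) && touch e (Q i) (Q j).

Definition clique_free e r t :=
  forall (I : finType) (J : {set I}) (Q : I -> {set T}), family e r J Q ->
    t <= #|J| -> ~ {in J &, forall i j, i != j -> touch e (Q i) (Q j)}.

Definition sparse e r mu N :=
  forall (I : finType) (J : {set I}) (Q : I -> {set T}), family e r J Q ->
    #|J| <= N -> edges (near e Q) J <= mu * #|J|.

Lemma familyS e f m n (I : finType) (J K : {set I}) Q :
  subrel e f -> m <= n -> K \subset J -> family e m J Q -> family f n K Q.
Proof.
move=> ef le_mn /subsetP sKJ [rJ dJ]; split=> [i /sKJ /rJ|i j /sKJ iJ /sKJ jJ].
  exact: radS.
exact: dJ.
Qed.

Lemma near_sym e (I : finType) (Q : I -> {set T}) :
  symmetric e -> symmetric (near e Q).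
Proof. by move=> es i j; rewrite /near eq_sym touch_sym. Qed.

Lemma near_irrefl e (I : finType) (Q : I -> {set T}) : irreflexive (near e Q).
Proof. by move=> i; rewrite /near eqxx. Qed.

Lemma clique_freeS e f m n t : subrel e f -> m <= n ->
  clique_free f n t -> clique_free e m t.
Proof.
move=> ef le_mn cf I J Q fam le_t all_touch.
apply: (cf _ _ _ (familyS ef le_mn (subxx _) fam)) => // i j iJ jJ ij.
exact: touchS (all_touch i j iJ jJ ij).
Qed.

Lemma sparseS e f m n mu N : subrel e f -> m <= n ->
  sparse f n mu N -> sparse e m mu N.
Proof.
move=> ef le_mn sp I J Q fam le_N.
apply: leq_trans (sp _ _ _ (familyS ef le_mn (subxx _) fam) le_N).
by apply: leq_edges => i j _ _ /andP[ij /touchS t]; rewrite /near ij t.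
Qed.

Lemma sparse_hsparse e r mu N (I : finType) (J : {set I}) Q :
  sparse e r mu N -> family e r J Q -> #|J| <= N -> hsparse (near e Q) J mu.
Proof.
move=> sp fam le_N K sKJ; apply: sp.
  exact: familyS fam.
exact: leq_trans (subset_leq_card sKJ) le_N.
Qed.

(** Each used connector is absorbed by one of its two pieces, which realises [H] inside a minor of
    depth [r + (2 * r').+1]; density and clique bounds for such minors then apply to [H]. *)
Lemma family_packing e r r' (I Y : finType) (inc : Y -> I -> bool)
    (K : {set I}) (Q : I -> {set T}) (Y0 : {set Y}) (R : Y -> {set T}) :
  symmetric e -> (exists i0, i0 \in K) ->
  family e r K Q -> family e r' Y0 R ->
  {in K & Y0, forall i y, [disjoint Q i & R y]} ->
  {in K & Y0, forall i y, inc y i -> touch e (Q i) (R y)} ->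
  exists (X : {set Y}) (H : rel I) (Q' : I -> {set T}),
  [/\ X \subset Y0, symmetric H, irreflexive H, #|X| <= edges H K &
  [/\ family e (r + (2 * r').+1) K Q',
      {in K &, forall i j, H i j -> near e Q' i j} &
      forall y, y \in Y0 -> y \notin X -> {in K &, forall i j,
        i != j -> inc y i -> inc y j -> H i j}]].
Proof.
move=> es K0 [rQ dQ] [rR dR] dQR incP.
have [X [al [H [sXY Hs Hi alP [Hw cX Hc]]]]] := packing inc Y0 K0.
have sX y : y \in X -> y \in Y0 by move/(subsetP sXY).
pose Q' i := Q i :|: \bigcup_(y in [set y in X | al y == i]) R y.
exists X, H, Q'; split=> //; split=> //.
- split=> [i iK|i j iK jK ij].
    apply: rad_union; [by []|exact: rQ|move=> y; rewrite inE => /andP[yX /eqP yi]].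
    have [_ incy] := alP y yX.
    by split; [apply: rR; exact: sX|apply: incP => //; [exact: sX|rewrite -yi]].
  rewrite -setI_eq0; apply/eqP/setP => x; rewrite !inE; apply/negP.
  case/andP => /orP[xi|/bigcupP[y]] => [/orP[xj|/bigcupP[y]]|].
  + by have /pred0P/(_ x) := dQ _ _ iK jK ij; rewrite /= xi xj.
  + rewrite inE => /andP[/sX yY _] xy.
    by have /pred0P/(_ x) := dQR _ _ iK yY; rewrite /= xi xy.
  rewrite inE => /andP[yX yi] xy; have yY := sX _ yX.
  case/orP => [xj|/bigcupP[z]].
    by have /pred0P/(_ x) := dQR _ _ jK yY; rewrite /= xj xy.
  rewrite inE => /andP[zX zj] xz; have zY := sX _ zX.
  have yz : y != z by apply: contraNneq ij => yz; rewrite -(eqP yi) -(eqP zj) yz.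
  by have /pred0P/(_ x) := dR _ _ yY zY yz; rewrite /= xy xz.
move=> i j iK jK Hij; rewrite /near.
have -> /= : i != j by apply: contraTneq Hij => ->; rewrite Hi.
have sub k y : y \in X -> al y = k -> R y \subset Q' k.
  move=> yX yk; rewrite subsetU //; apply/orP; right.
  by apply: (bigcup_sup y); rewrite // inE yX yk eqxx.
have [y yX [[yi yj]|[yj yi]]] := Hw i j Hij.
  rewrite touch_sym //; have := incP j y jK (sX _ yX) yj.
  by apply: touchS => //; [exact: subsetUl|exact: sub].
have := incP i y iK (sX _ yX) yi.
by apply: touchS => //; [exact: subsetUl|exact: sub].
Qed.

End Families.

(** * Minimum degree and sets dominating most vertices many times *)

Section Degrees.
Variables (I : finType) (f : rel I).
Hypotheses (fs : symmetric f) (fi : irreflexive f).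
Implicit Types J A : {set I}.

Lemma edgesD1 J i : i \in J ->
  edges f J <= edges f (J :\ i) + 2 * #|[set j in J | f i j]|.
Proof.
move=> iJ; rewrite /edges (bigD1 i) //= mul2n -addnn addnCA leq_add2l.
have -> : \sum_(k in J :\ i) #|[set j in J :\ i | f k j]| =
          \sum_(k in J | k != i) #|[set j in J :\ i | f k j]|.
  by apply: eq_bigl => k; rewrite !inE andbC.
have -> : #|[set j in J | f i j]| = \sum_(k in J | k != i) f k i.
  rewrite -sum1_card [LHS](eq_bigl (fun k => (k \in J) && f i k)) => [|k]; last by rewrite inE.
  rewrite big_mkcondr [RHS]big_mkcondr /=; apply: eq_bigr => k _.
  by have [->|_] := eqVneq k i; rewrite ?fi //= fs; case: (f i k).
rewrite -big_split /=; apply: leq_sum => k /andP[kJ ki].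
rewrite (cardsD1 i) addnC leq_add //; last by rewrite inE iJ.
by apply/subset_leq_card/subsetP => j; rewrite !inE -andbA.
Qed.

(** Deleting a vertex of degree below [q] removes fewer than [2 * q] ordered pairs, so the density
    hypothesis survives and keeps the set nonempty. *)
Lemma min_degree_sub J q : 2 * q * #|J| < edges f J ->
  exists J', [/\ J' \subset J, J' != set0 &
    {in J', forall i, q <= #|[set j in J' | f i j]|}].
Proof.
have [n] := ubnP #|J|; elim: n J => // n IH J ltn big.
have [/exists_inP[i iJ low]|/exists_inPn far] :=
  boolP [exists i in J, #|[set j in J | f i j]| < q]; last first.
  exists J; split=> // [|i /far]; last by rewrite -leqNgt.
  by apply: contraTneq big => ->; rewrite /edges big_set0.
have [||J' [sJ' J'0 J'P]] := IH (J :\ i).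
- by rewrite (cardsD1 i J) iJ in ltn.
- by have := edgesD1 iJ; rewrite (cardsD1 i J) iJ in big; nia.
by exists J'; split=> //; apply: subset_trans sJ' (subsetDl _ _).
Qed.

(** Greedy choice: [phi] credits each vertex with its neighbours in [A], up to [t]. A largest [A]
    whose members have earned [(q - t) / 4] of credit on average works, as the total credit is at
    most [t * #|J|]. *)
Lemma multi_dominating J q t : t < q ->
  {in J, forall i, q <= #|[set j in J | f i j]|} ->
  exists A, [/\ A \subset J, (q - t) * #|A| <= 4 * (t * #|J|) &
    4 * #|[set b in J | #|[set a in A | f b a]| < t]| <= #|J|].
Proof.
move=> ltq degJ.
pose phi A := \sum_(b in J) minn t #|[set a in A | f b a]|.
pose ok A := (A \subset J) && ((q - t) * #|A| <= 4 * phi A).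
have ok0 : ok set0 by rewrite /ok sub0set cards0 muln0.
have [A /andP[sAJ cA] maxA] := arg_maxnP (fun A => #|A|) ok0.
exists A; split=> //.
  apply: leq_trans cA _; rewrite leq_mul2l /= mulnC -sum_nat_const.
  by apply: leq_sum => b _; apply: geq_minl.
set D := [set b in J | _]; rewrite leqNgt; apply/negP => bigD.
(* A deficient vertex has at least [q - t] neighbours outside [A]; with more than a quarter of [J]
   deficient, averaging finds a vertex whose addition earns [(q - t) / 4]. *)
have [a aJ] : exists2 a, a \in J :\: A & q - t <= 4 * #|[set b in D | f b a]|.
  apply/exists_inP; apply: contraT => /exists_inPn far.
  have: \sum_(a in J :\: A) 4 * #|[set b in D | f b a]| <= (q - t) * #|J|.
    apply: leq_trans (_ : \sum_(a in J :\: A) (q - t) <= _).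
      by apply: leq_sum => a /far; rewrite -ltnNge => /ltnW.
    by rewrite sum_nat_const mulnC leq_mul2l subset_leq_card ?subsetDl ?orbT.
  rewrite -big_distrr /= leqNgt => /negP[].
  have -> : \sum_(a in J :\: A) #|[set b in D | f b a]| =
            \sum_(b in D) #|[set a in J :\: A | f b a]|.
    under eq_bigr do rewrite -sum1dep_card big_mkcondr.
    by rewrite exchange_big /=; apply: eq_bigr => b _; rewrite -sum1dep_card -big_mkcondr.
  have: \sum_(b in D) (q - t) <= \sum_(b in D) #|[set a in J :\: A | f b a]|.
    apply: leq_sum => b; rewrite inE => /andP[bJ lowb].
    have := degJ b bJ; rewrite -(cardsID A) leq_subLR => /leq_trans; apply.
    rewrite leq_add //.
      apply: leq_trans (ltnW lowb); apply/subset_leq_card/subsetP => j.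
      by rewrite !inE => /andP[/andP[_ ->] ->].
    by apply/subset_leq_card/subsetP => j; rewrite !inE => /andP[-> /andP[-> ->]].
  rewrite sum_nat_const; nia.
move=> bigA; move: aJ => /setDP[aJ aA].
suff okaA : ok (a |: A).
  by have := maxA _ okaA; rewrite /= cardsU1 aA add1n ltnn.
rewrite /ok subUset sub1set aJ sAJ cardsU1 aA /= mulnDr muln1.
suff: phi A + #|[set b in D | f b a]| <= phi (a |: A) by lia.
have -> : #|[set b in D | f b a]| = \sum_(b in J) ((b \in D) && f b a).
  rewrite -sum1dep_card big_mkcond [RHS]big_mkcond /=; apply: eq_bigr => b _.
  by rewrite inE; case: (b \in J) => //=; case: (_ && _).
rewrite -big_split /=; apply: leq_sum => b bJ; rewrite inE bJ /=.
have le : #|[set x in A | f b x]| <= #|[set x in a |: A | f b x]|.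
  by apply/subset_leq_card/subsetP => x; rewrite !inE => /andP[-> ->]; rewrite orbT.
have [lowb|highb] := ltnP #|[set x in A | f b x]| t; last first.
  by rewrite addn0 leq_min leqnn (leq_trans highb le).
have [fba|_] := boolP (f b a); last by rewrite addn0 leq_min le (ltnW lowb).
suff -> : #|[set x in a |: A | f b x]| = #|[set x in A | f b x]|.+1.
  by rewrite addn1 leq_min lowb leqnn.
have -> : [set x in a |: A | f b x] = a |: [set x in A | f b x].
  by apply/setP => x; rewrite !inE; have [->|] := eqVneq x a.
by rewrite cardsU1 inE (negPf aA).
Qed.

End Degrees.

(** * Density of shallow minors in the absence of clique minors *)

Definition minor_depth j r := iter j (fun r => 3 * r + 1) r.

Section Density.
Variables (T : finType) (e : rel T).
Hypothesis es : symmetric e.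

(* Contracting almost all pieces onto a small multi-dominating set [A] either makes
   the neighbourhood of some piece a clique, or keeps linearly many edges. *)
Lemma contract_step r t mu (I : finType) (J : {set I}) Q :
  0 < t -> 70 * t <= mu ->
  family e r J Q -> clique_free e (3 * r + 1) t -> mu * #|J| < edges (near e Q) J ->
  exists (A : {set I}) (Q' : I -> {set T}),
    [/\ family e (3 * r + 1) A Q', A != set0, mu * #|A| <= 32 * t * #|J| &
        mu * #|A| < 64 * t * edges (near e Q') A].
Proof.
move=> t0 bigmu famJ cf bigE; set g := near e Q in bigE.
have gs : symmetric g := near_sym _ es; have gi : irreflexive g := near_irrefl _ _.
pose q := mu./2.
have qmu : 2 * q <= mu <= 2 * q + 1 by rewrite /q; lia.
have [|J' [sJ J'0 degJ']] := @min_degree_sub I g gs gi J q.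
  by apply: leq_ltn_trans bigE; rewrite leq_mul2r; lia.
have qt : t < q by lia.
have [A [sAJ cA cD]] := multi_dominating qt degJ'.
set Def := [set b in J' | _] in cD.
(* The connectors: pieces outside [A] with at least [t] neighbours in [A]. They turn out to be at
   least half of [J']. *)
pose Y0 := J' :\: A :\: Def.
have n0 : 0 < #|J'| by rewrite card_gt0.
have leJ : #|J'| <= #|J| := subset_leq_card sJ.
have cY : #|J'| <= #|A| + #|Def| + #|Y0|.
  have sub : J' \subset A :|: Def :|: Y0.
    by apply/subsetP => i iJ'; rewrite !inE iJ' /=; case: (i \in A); case: (_ < t).
  apply: leq_trans (subset_leq_card sub) _.
  by rewrite (leq_trans (leq_card_setU _ _)) // leq_add2r leq_card_setU.
(* The constant 70 enters here: [q - t] is at least [34 * t], against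
   [(q - t) * #|A| <= 4 * (t * #|J'|)]. *)
have A4 : 8 * #|A| <= #|J'| by nia.
have Y2 : #|J'| <= 2 * #|Y0| by lia.
have /set0Pn[y0 y0Y] : Y0 != set0 by rewrite -card_gt0; lia.
have degA y : y \in Y0 -> t <= #|[set a in A | g y a]|.
  by rewrite !inE => /andP[]; case: (y \in J'); rewrite ?andbF //= -leqNgt.
have A0 : exists a, a \in A.
  have := leq_trans t0 (degA _ y0Y); rewrite card_gt0 => /set0Pn[a].
  by rewrite inE => /andP[aA _]; exists a.
have sA : A \subset J := subset_trans sAJ sJ.
have sY : Y0 \subset J.
  by apply/subsetP => y /setDP[/setDP[/(subsetP sJ)]].
have er : subrel e e by [].
have famA := familyS er (leqnn r) sA famJ; have famY := familyS er (leqnn r) sY famJ.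
have [||X [H [Q' [sX Hs Hi cX [fam' Hn Hc]]]]] :=
  @family_packing T e r r I I g A Q Y0 Q es A0 famA famY.
- move=> a y aA /[dup] yY /setDP[/setDP[_ yA] _].
  apply: (proj2 famJ _ _ (subsetP sA _ aA) (subsetP sY _ yY)).
  by apply: contraNneq yA => <-.
- by move=> a y aA yY; rewrite /g /near touch_sym // => /andP[].
have E3 : r + (2 * r).+1 = 3 * r + 1 by lia.
rewrite E3 in fam'.
have YX : Y0 \subset X.
  apply/subsetP => y yY; apply: contraT => yX.
  case: (cf _ [set a in A | g y a] Q' _ (degA y yY)).
    by apply: familyS fam' => //; apply/subsetP => a; rewrite inE => /andP[].
  move=> a b; rewrite !inE => /andP[aA ga] /andP[bA gb] ab.
  by have /andP[] := Hn a b aA bA (Hc y yY yX a b aA bA ab ga gb).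
have leE : #|Y0| <= edges (near e Q') A.
  apply: leq_trans (subset_leq_card YX) (leq_trans cX _).
  exact: leq_edges.
have A1 : 0 < #|A| by rewrite card_gt0; apply/set0Pn.
exists A, Q'; split=> //; first by apply/set0Pn.
- nia.
- nia.
Qed.

Lemma edges_le_sqr (I : finType) (f : rel I) (J : {set I}) :
  edges f J <= #|J| * #|J|.
Proof.
rewrite edgesE -cardsX; apply/subset_leq_card/subsetP => p.
by rewrite inE => /andP[].
Qed.

(** Each contraction turns depth [r] into [3 * r + 1], divides the order by at least [mu / (32 * t)]
    and lowers the density only by a factor of order [t]. After [j] rounds the density still cannot
    exceed the order. *)
Lemma dense_minor j r t mu (I : finType) (J : {set I}) Q : 0 < t ->
  family e r J Q -> clique_free e (minor_depth j r) t ->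
  mu * #|J| < edges (near e Q) J ->
  mu ^ j.+1 <= (70 * t) ^ (j.+1 * j.+2) * #|J|.
Proof.
move=> t0; elim: j r mu J Q => [|j IH] r mu J Q fam cf bigE.
  have := leq_trans bigE (edges_le_sqr _ _); rewrite ltn_mul2r => /andP[_ le].
  by rewrite expn1 (leq_trans (ltnW le)) // leq_pmull // expn_gt0; lia.
have J0 : 0 < #|J|.
  rewrite card_gt0; apply: contraTneq bigE => ->.
  by rewrite /edges big_set0.
have [small|big] := ltnP mu (70 * t).
  apply: leq_trans (_ : (70 * t) ^ j.+2 <= _); first by rewrite leq_exp2r // ltnW.
  apply: leq_trans (leq_pmulr _ J0); rewrite leq_pexp2l //; first by lia.
  by rewrite leq_pmulr.
have cf1 : clique_free e (3 * r + 1) t.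
  apply: clique_freeS cf => //; rewrite /minor_depth iterSr.
  by elim: j {IH} => //= j IH; lia.
have [A [Q' [fam' A0 cA cE]]] := contract_step t0 big fam cf1 bigE.
pose mu' := mu.-1 %/ (64 * t).
have mu'E : mu' * (64 * t) <= mu.-1 by apply: leq_divM.
have muE : mu <= 2 * (64 * t) * mu'.
  have: mu.-1 < (mu').+1 * (64 * t) by rewrite /mu' ltn_ceil //; lia.
  have: 0 < mu' by rewrite /mu' divn_gt0; lia.
  nia.
have le : mu' ^ j.+1 <= (70 * t) ^ (j.+1 * j.+2) * #|A|.
  apply: (IH (3 * r + 1) mu' A Q' fam').
    by apply: clique_freeS cf => //; rewrite /minor_depth iterSr.
  have A1 : 0 < #|A| by rewrite card_gt0.
  have: mu' * (64 * t) * #|A| <= mu.-1 * #|A| by rewrite leq_mul2r mu'E orbT.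
  nia.
apply: leq_trans (_ : mu * ((128 * t) ^ j.+1 * mu' ^ j.+1) <= _).
  rewrite -expnMn expnS leq_mul2l leq_exp2r //.
  by apply/orP; right; lia.
set c := 70 * t in le *.
apply: leq_trans (_ : (128 * t) ^ j.+1 * (c ^ (j.+1 * j.+2) * (32 * t * #|J|)) <= _).
  rewrite mulnCA leq_mul2l; apply/orP; right.
  by apply: leq_trans (leq_mul (leqnn mu) le) _; rewrite mulnCA leq_mul2l cA orbT.
have -> : j.+2 * j.+3 = 2 * j.+1 + (j.+1 * j.+2 + 2) by lia.
move: (j.+1 * j.+2) => m; rewrite 2!expnD expnM !mulnA leq_mul2r -!mulnA; apply/orP; right.
apply: leq_mul; first by rewrite leq_exp2r // /c; nia.
by rewrite leq_mul2l /c; apply/orP; right; nia.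
Qed.

(** Contrapositive of [dense_minor]: a larger [j] lets [mu] be a smaller power of [N], at the price
    of excluding cliques at greater depth. *)
Lemma clique_free_sparse j r t mu N : 0 < t -> clique_free e (minor_depth j r) t ->
  (70 * t) ^ (j.+1 * j.+2) * N < mu ^ j.+1 -> sparse e r mu N.
Proof.
move=> t0 cf big I J Q fam leN; rewrite leqNgt; apply/negP => /(dense_minor t0 fam cf).
rewrite leqNgt => /negP[]; apply: leq_ltn_trans big.
by rewrite leq_mul2l leN orbT.
Qed.

End Density.

(** * One stage: clusters of pieces with disjoint closed neighbourhoods *)

Section Stage.
Variables (T : finType) (e : rel T).
Hypothesis es : symmetric e.

Definition coincident (I Y : finType) (inc : Y -> I -> bool) (Y0 : {set Y}) : rel I :=
  fun i j => (i != j) && [exists y in Y0, inc y i && inc y j].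

Lemma coincident_sym (I Y : finType) (inc : Y -> I -> bool) Y0 :
  symmetric (coincident inc Y0).
Proof.
move=> i j; rewrite /coincident eq_sym; congr (_ && _).
by apply: eq_existsb => y; rewrite [inc y i && _]andbC.
Qed.

Lemma coincident_irrefl (I Y : finType) (inc : Y -> I -> bool) Y0 :
  irreflexive (coincident inc Y0).
Proof. by move=> i; rewrite /coincident eqxx. Qed.

(** After a packing, [H] has at most [mu * #|K'|] ordered pairs on a subset [K']. A coincident pair
    outside [H] shares a used connector; these are no more numerous, and each accounts for at most
    [m * m] pairs. *)
Lemma coincident_hsparse r r' m mu N (I Y : finType) (inc : Y -> I -> bool)
    (K : {set I}) (Q : I -> {set T}) (Y0 : {set Y}) (R : Y -> {set T}) :
  family e r K Q -> family e r' Y0 R ->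
  {in K & Y0, forall i y, [disjoint Q i & R y]} ->
  {in K & Y0, forall i y, inc y i -> touch e (Q i) (R y)} ->
  {in Y0, forall y, #|[set i in K | inc y i]| <= m} ->
  sparse e (r + (2 * r').+1) mu N -> #|K| <= N ->
  hsparse (coincident inc Y0) K ((m * m).+1 * mu).
Proof.
move=> famK famY dQR incP low sp leN K' sK.
have [->|/set0Pn K0] := eqVneq K' set0; first by rewrite /edges big_set0.
have sK' i : i \in K' -> i \in K by move/(subsetP sK).
have er : subrel e e by [].
have [||X [H [Q' [sX Hs Hi cX [fam' Hn Hc]]]]] :=
  @family_packing T e r r' I Y inc K' Q Y0 R es K0 (familyS er (leqnn r) sK famK) famY.
- by move=> i y /sK' iK; apply: dQR.
- by move=> i y /sK' iK; apply: incP.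
have cH : edges H K' <= mu * #|K'|.
  apply: leq_trans (sp _ _ _ fam' (leq_trans (subset_leq_card sK) leN)).
  exact: leq_edges.
suff cF : edges (coincident inc Y0) K' <= edges H K' + m * m * #|X| by nia.
have: #|\bigcup_(y in X) setX [set i in K' | inc y i] [set i in K' | inc y i]|
      <= m * m * #|X|.
  apply: leq_card_bigcup => y /(subsetP sX) yY; rewrite cardsX.
  have le : #|[set i in K' | inc y i]| <= m.
    apply: leq_trans (low y yY); apply/subset_leq_card/subsetP => i.
    by rewrite !inE => /andP[/sK' -> ->].
  exact: leq_mul.
rewrite -(leq_add2l (edges H K')) => /(leq_trans _); apply.
rewrite !edgesE; apply: leq_trans (leq_card_setU _ _).
apply/subset_leq_card/subsetP => -[i j]; rewrite !inE /=.
case/andP=> /andP[iK jK] /andP[ij /exists_inP[y yY /andP[yi yj]]].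
rewrite iK jK /=; have [yX|yX] := boolP (y \in X).
  by apply/orP; right; apply/bigcupP; exists y; rewrite // !inE /= iK jK yi.
by rewrite (Hc y yY yX i j iK jK ij yi yj).
Qed.

Lemma family_singletons (X : {set T}) : family e 0 X (fun x => [set x]).
Proof.
split=> [x _|x y _ _ xy]; first exact: rad1.
by rewrite disjoints1 inE.
Qed.

Lemma touch1 X x : touch e X [set x] = [exists y in X, e y x].
Proof.
apply/touchP/exists_inP => [[y [z [yX /set1P-> eyx]]]|[y yX eyx]]; first by exists y.
by exists y, x; rewrite inE.
Qed.

(** Two independent sets are taken in turn: one makes the pieces pairwise non-touching, the other,
    in the graph [H] of a packing by outside vertices, leaves the used vertices [X] as the only
    possible common neighbours. *)
Lemma common_neighbours r mu N (I : finType) (J : {set I}) Q :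
  family e r J Q -> sparse e r.+1 mu N -> #|J| <= N -> J != set0 ->
  exists (K : {set I}) (X : {set T}),
  [/\ K \subset J, #|J| <= mu.+1 * mu.+1 * #|K|, #|X| <= mu * mu.+1 * #|K|,
      {in K & X, forall i x, x \notin Q i} &
      {in K &, forall i j, i != j -> ~~ touch e (Q i) (Q j) /\
         nb e (Q i) :&: nb e (Q j) \subset X}].
Proof.
move=> famJ sp leN J0; have er : subrel e e by [].
have sp0 : sparse e r mu N := sparseS er (leqnSn r) sp.
have [K0 [sK0 ind0 cJ]] := indep_card (near_sym Q es) (near_irrefl e Q)
  (sparse_hsparse sp0 famJ leN).
have fam0 := familyS er (leqnn r) sK0 famJ.
have K0n : exists i, i \in K0.
  by apply/set0Pn; rewrite -card_gt0; move: J0; rewrite -card_gt0; nia.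
pose inc (x : T) i := touch e (Q i) [set x].
pose Y0 := ~: \bigcup_(i in K0) Q i.
have [||X [H [Q' [sX Hs Hi cX [fam' Hn Hc]]]]] :=
  @family_packing T e r 0 I T inc K0 Q Y0 (fun x => [set x]) es K0n fam0
    (family_singletons Y0).
- move=> i x iK; rewrite inE => xU; rewrite disjoint_sym disjoints1.
  by apply: contra xU => xi; apply/bigcupP; exists i.
- by [].
have cK0 : #|K0| <= N := leq_trans (subset_leq_card sK0) leN.
have cH : edges H K0 <= mu * #|K0|.
  apply: leq_trans (sp _ _ _ _ cK0); last by rewrite muln0 addn1 in fam'; exact: fam'.
  exact: leq_edges.
have spH : hsparse H K0 mu.
  move=> L sL; apply: leq_trans (leq_edges (g := near e Q') _) _.
    by move=> i j /(subsetP sL) iK /(subsetP sL); exact: Hn.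
  rewrite muln0 addn1 in fam'.
  by apply: (sparse_hsparse sp fam' cK0).
have [K [sK ind cK]] := indep_card Hs Hi spH.
have sK' i : i \in K -> i \in K0 by move/(subsetP sK).
exists K, X; split.
- exact: subset_trans sK sK0.
- by apply: leq_trans cJ _; rewrite -mulnA leq_mul2l cK orbT.
- by apply: leq_trans (leq_trans cX cH) _; rewrite -mulnA leq_mul2l cK orbT.
- move=> i x iK /(subsetP sX); rewrite inE; apply: contra => xi.
  by apply/bigcupP; exists i; rewrite ?sK'.
move=> i j iK jK ij; have nt a b : a \in K0 -> b \in K0 -> a != b ->
    ~~ touch e (Q a) (Q b).
  by move=> aK bK ab; have := ind0 a b aK bK; rewrite /near ab.
split; first by apply: nt; rewrite ?sK'.
have out a b x : a \in K0 -> b \in K0 -> a != b -> x \in Q a -> x \notin nb e (Q b).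
  move=> aK bK ab xa; apply/nbP => -[xb|[y yb eyx]].
    by have /pred0P/(_ x) := proj2 fam0 a b aK bK ab; rewrite /= xa xb.
  by case/touchP: (nt a b aK bK ab); exists x, y; rewrite es.
have inc_nb a x : x \in Y0 -> a \in K0 -> x \in nb e (Q a) -> inc x a.
  rewrite inE => xU aK /nbP[xa|[y ya eyx]].
    by case/bigcupP: xU; exists a.
  by rewrite /inc touch1; apply/exists_inP; exists y.
apply/subsetP => x /setIP[xi xj]; apply: contraT => xX.
have xY : x \in Y0.
  rewrite inE; apply/bigcupP => -[a aK xa].
  have [ai|ai] := eqVneq a i.
    have aj : a != j by rewrite ai.
    by rewrite (negPf (out a j x aK (sK' _ jK) aj xa)) in xj.
  by rewrite (negPf (out a i x aK (sK' _ iK) ai xa)) in xi.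
have := ind i j iK jK.
by rewrite (Hc x xY xX i j) ?sK' //; apply: inc_nb; rewrite ?sK'.
Qed.

(** The pieces and the singletons of [X] together form one family, indexed by a sum type, and
    sparsity of that family bounds the incidences. *)
Lemma few_neighbours r mu N (I : finType) (K : {set I}) Q (X : {set T}) :
  family e r K Q -> sparse e r mu N -> #|K| + #|X| <= N ->
  {in K & X, forall i x, x \notin Q i} ->
  \sum_(i in K) #|[set x in X | x \in nb e (Q i)]| <= mu * (#|K| + #|X|).
Proof.
move=> famK sp leN KX.
pose J : {set I + T} := [set s | match s with inl i => i \in K | inr x => x \in X end].
pose Qs s := match s with inl i => Q i | inr x => [set x] end.
have famJ : family e r J Qs.
  split=> [[i|x]|[i|x] [j|y]]; rewrite !inE /=.
  - exact: (proj1 famK).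
  - by move=> _; apply: radS (rad1 e x).
  - exact: (proj2 famK).
  - by move=> iK yX _; rewrite disjoint_sym disjoints1 KX.
  - by move=> xX jK _; rewrite disjoints1 KX.
  - by move=> _ _ xy; rewrite disjoints1 inE; apply: contraNneq xy => ->.
have cJ : #|J| = #|K| + #|X|.
  by rewrite -!sum1_card big_sumType /=; congr (_ + _); apply: eq_bigl => i; rewrite inE.
rewrite -cJ; apply: leq_trans (sp _ _ _ famJ _); last by rewrite cJ.
rewrite /edges big_sumType /=; apply: leq_trans (leq_addr _ _).
rewrite [X in _ <= X](eq_bigl (mem K)); last by move=> i; rewrite /= inE.
apply: leq_sum => i iK; rewrite -(card_imset _ (@inr_inj I T)).
apply/subset_leq_card/subsetP => s /imsetP[x]; rewrite inE => /andP[xX xi] ->.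
rewrite !inE xX /near /= touch1; case/nbP: xi => [xi|[y yi eyx]].
  by rewrite (negPf (KX i x iK xX)) in xi.
by apply/exists_inP; exists y.
Qed.

(** In [clusters], [out_bound] limits the contacts of a kept piece with [X], and the next two bound
    the coincidence graphs used there. [loss] multiplies the cost of [common_neighbours], of two
    halvings, and of two independent sets. *)
Definition out_bound mu := 2 * (mu * (mu * mu.+1).+1).
Definition coin_bound m mu := (m * m).+1 * mu.
Definition back_bound mu := coin_bound (out_bound mu) mu.
Definition loss mu :=
  mu.+1 * mu.+1 * (4 * ((back_bound mu).+1 * (coin_bound (back_bound mu) mu).+1)).

Lemma loss_le mu : 1 < mu -> loss mu <= mu ^ 52.
Proof.
move=> mu1; have S a n : a <= mu ^ n -> a.+1 <= mu ^ n.+1.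
  move=> le; rewrite expnS; have : 0 < mu ^ n by rewrite expn_gt0 ltnW.
  nia.
have M a b m n : a <= mu ^ m -> b <= mu ^ n -> a * b <= mu ^ (m + n).
  by move=> la lb; rewrite expnD leq_mul.
have e1 : mu <= mu ^ 1 by rewrite expn1.
have e2 : 2 <= mu ^ 1 by rewrite expn1.
have e4 : 4 <= mu ^ 2 := M _ _ _ _ e2 e2.
have out6 : out_bound mu <= mu ^ 6 := M _ _ _ _ e2 (M _ _ _ _ e1 (S _ _ (M _ _ _ _ e1 (S _ _ e1)))).
have back : back_bound mu <= mu ^ 14 := M _ _ _ _ (S _ _ (M _ _ _ _ out6 out6)) e1.
have coin : coin_bound (back_bound mu) mu <= mu ^ 30 :=
  M _ _ _ _ (S _ _ (M _ _ _ _ back back)) e1.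
exact: (M _ _ _ _ (M _ _ _ _ (S _ _ e1) (S _ _ e1))
  (M _ _ _ _ e4 (M _ _ _ _ (S _ _ back) (S _ _ coin)))).
Qed.

(* Pieces are grouped by the least element, in a degenerate order, among the few
   vertices through which they can meet other pieces. *)
Lemma clusters r mu N (I : finType) (J : {set I}) Q : 0 < mu ->
  family e r J Q -> sparse e (2 * r).+2 mu N -> mu.+1 * mu.+1 * #|J| <= N ->
  J != set0 ->
  exists (K : {set I}) (lam : I -> T),
  [/\ K \subset J, #|J| <= loss mu * #|K|,
      {in K, forall i, lam i \in nb e (Q i)},
      {in K &, forall i j, i != j -> lam i \notin Q j} &
      {in K &, forall i j, lam i != lam j ->
         [disjoint nb e (Q i) & nb e (Q j)]}].
Proof.
move=> mu0 famJ sp leN J0; have er : subrel e e by [].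
have leJN : #|J| <= N by nia.
have sp1 : sparse e r.+1 mu N by apply: sparseS sp => //; lia.
have [K1 [X [sK1 cJ cX K1X sep]]] := common_neighbours famJ sp1 leJN J0.
pose out i := [set x in X | x \in nb e (Q i)].
have cK1J := subset_leq_card sK1.
have leN1 : #|K1| + #|X| <= N by nia.
have fam1 := familyS er (leqnn r) sK1 famJ.
have sp0 : sparse e r mu N := sparseS er (leqnSn r) sp1.
have sum_out := few_neighbours fam1 sp0 leN1 K1X.
set M := mu * (mu * mu.+1).+1.
(* Markov: the average of [#|out i|] over [K1] is at most [M], so at least half of [K1] survives. *)
pose K2 := [set i in K1 | #|out i| <= 2 * M].
have cK2 : #|K1| <= 2 * #|K2|.
  have E : #|K1| = #|K2| + #|K1 :\: K2|.
    by rewrite -(cardsID K2) (setIidPr _) //; apply/subsetP => i; rewrite inE => /andP[].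
  have: \sum_(i in K1 :\: K2) (2 * M).+1 <= \sum_(i in K1) #|out i|.
    rewrite [X in _ <= X](big_setID K2) /=; apply: leq_trans (leq_addl _ _).
    by apply: leq_sum => i; rewrite !inE => /andP[h iK]; rewrite iK -ltnNge in h.
  rewrite sum_nat_const => le.
  have {}le : #|K1 :\: K2| * (2 * M).+1 <= M * #|K1|.
    apply: leq_trans le (leq_trans sum_out _).
    by rewrite /M -mulnA leq_mul2l mulSn leq_add2l cX orbT.
  nia.
have sK2 i : i \in K2 -> i \in K1 by rewrite inE => /andP[].
have K2n : 0 < #|K2| by move: J0; rewrite -card_gt0; nia.
have Qn i : i \in K1 -> exists x, x \in Q i.
  by move=> iK; have [c ci _] := proj1 fam1 i iK; exists c.
have [i0 i0K2] : exists i, i \in K2 by apply/set0Pn; rewrite -card_gt0.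
have [x0 _] := Qn i0 (sK2 _ i0K2).
pose K3 := [set i in K2 | out i != set0].
have sK3 i : i \in K3 -> i \in K1 by rewrite inE => /andP[/sK2].
have common i j x : i \in K1 -> j \in K1 -> i != j -> x \in nb e (Q i) ->
    x \in nb e (Q j) -> x \in out i /\ x \in out j.
  move=> iK jK ij xi xj; have [_ /subsetP sub] := sep i j iK jK ij.
  have xX : x \in X by apply: sub; apply/setIP.
  by split; apply/setIdP.
(* If half of the pieces have no contact with [X], their closed neighbourhoods are already disjoint
   and each is its own cluster, with any of its vertices as [lam]. *)
have [few|many] := leqP #|K2| (2 * #|K2 :\: K3|).
  exists (K2 :\: K3), (fun i => odflt x0 [pick x in Q i]).
  have lamP i : i \in K1 -> odflt x0 [pick x in Q i] \in Q i.
    by case/Qn => x xi; case: pickP => [//|/(_ x)]; rewrite xi.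
  split=> [|||i j|i j].
  - by apply/subsetP => i /setDP[/sK2/(subsetP sK1)].
  - rewrite /loss; move: (back_bound _) (coin_bound _ _) => b c.
    apply: leq_trans cJ _; rewrite -[X in _ <= X]mulnA leq_mul2l.
    by apply/orP; right; nia.
  - by move=> i /setDP[/sK2 iK _]; rewrite inE lamP.
  - move=> /setDP[/sK2 iK _] /setDP[/sK2 jK _] ij.
    have dij := proj2 fam1 i j iK jK ij.
    by rewrite (disjointFr dij (lamP i iK)).
  move=> /setDP[/[dup] iK2 /sK2 iK i3] /setDP[/sK2 jK _] lij.
  have ij : i != j by apply: contraNneq lij => ->.
  apply/pred0P => x; apply/negP => /andP[xi xj].
  have [xo _] := common i j x iK jK ij xi xj.
  by case/negP: i3; rewrite inE iK2; apply/set0Pn; exists x.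
have cK3 : #|K2| <= 2 * #|K3|.
  have E : #|K2| = #|K3| + #|K2 :\: K3|.
    by rewrite -(cardsID K3) (setIidPr _) //; apply/subsetP => i; rewrite inE => /andP[].
  lia.
(* Roles are exchanged: vertices of [X] are joined when some piece sees both, the pieces being
   connectors with at most [out_bound mu] incidences. *)
pose F2 := coincident (fun i x => x \in out i) K3.
have outX i x : x \in out i -> x \in X by rewrite inE => /andP[].
have outT i x : i \in K1 -> x \in out i -> touch e (Q i) [set x].
  move=> iK; rewrite inE => /andP[xX /nbP[xi|[y yi eyx]]].
    by rewrite (negPf (K1X i x iK xX)) in xi.
  by rewrite touch1; apply/exists_inP; exists y.
have famX := family_singletons X.
have fam3 : family e r K3 Q.
  by apply: familyS fam1 => //; apply/subsetP => i; exact: sK3.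
have sp2 : sparse e (0 + (2 * r).+1) mu N by apply: sparseS sp.
have cXN : #|X| <= N by lia.
have hF2 : hsparse F2 X (back_bound mu).
  apply: (coincident_hsparse famX fam3 _ _ _ sp2 cXN).
  - by move=> x i xX /sK3 iK; rewrite disjoints1 K1X.
  - by move=> x i xX /sK3 iK xi; rewrite touch_sym // outT.
  - move=> i; rewrite inE => /andP[]; rewrite inE => /andP[_ le] _.
    apply: leq_trans le; apply/subset_leq_card/subsetP => x.
    by rewrite inE => /andP[].
have F2s : symmetric F2 by exact: coincident_sym.
have F2i : irreflexive F2 by exact: coincident_irrefl.
have [rk rkI rkP] := degenerate_rank F2s hF2.
(* With the least vertex as label, any other [y] in [out i] has [z i] among its at most
   [back_bound mu] lower neighbours in [F2]. *)
pose z i := [arg min_(x < odflt x0 [pick x in out i] | x \in out i) rk x].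
have zP i : i \in K3 -> z i \in out i /\ forall x, x \in out i -> rk (z i) <= rk x.
  rewrite inE /z => /andP[_ /set0Pn[y yi]]; case: arg_minnP => [|x xi le].
    by case: pickP => [//|/(_ y)]; rewrite yi.
  by split=> // y' /le.
pose w x := #|[set i in K3 | z i == x]|.
(* Independence in [F2] means that a piece of [K3] sees at most one vertex of [Z1], so clusters with
   labels in [Z1] cannot meet at a vertex of [Z1]. *)
have [Z1 [sZ1 ind1 cZ1]] := indep_weight w F2s F2i hF2.
have sZ1' x : x \in Z1 -> x \in X by move/(subsetP sZ1).
pose P x := [set x] :|: \bigcup_(i in [set i in K3 | z i == x]) Q i.
have zX i : i \in K3 -> z i \in X by case/zP => /outX.
have famP : family e (0 + (2 * r).+1) Z1 P.
  split=> [x xZ|x y xZ yZ xy].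
    apply: rad_union => //; first exact: rad1.
    move=> i; rewrite inE => /andP[iK /eqP <-]; split; first exact: (proj1 fam3).
    by rewrite touch_sym // outT ?sK3 //; case: (zP i iK).
  apply/pred0P => a; apply/negP => /= /andP[]; rewrite !inE.
  case/orP => [/eqP->|/bigcupP[i]]; [|rewrite inE => /andP[iK /eqP zi] ai].
    case/orP => [|/bigcupP[i]]; first by rewrite (negPf xy).
    by rewrite inE => /andP[iK _]; apply/negP/K1X; [exact: sK3|exact: sZ1'].
  case/orP => [/eqP E|/bigcupP[j]].
    by move: ai; rewrite E; apply/negP/K1X; [exact: sK3|exact: sZ1'].
  rewrite inE => /andP[jK /eqP zj] aj.
  have ij : i != j by apply: contraNneq xy => ij; rewrite -zi -zj ij.
  by have /pred0P/(_ a) := proj2 fam3 i j iK jK ij; rewrite /= ai aj.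
(* The other contacts of clusters are vertices [y] outside [Z1]. By the choice of labels only
   boundedly many clusters see such a [y], so a second independent set removes these contacts. *)
pose inc2 y x := [exists i in K3, (z i == x) && (y \in out i)].
pose Y0 := X :\: Z1.
have sp3 : sparse e (0 + (2 * r).+1 + (2 * 0).+1) mu N by apply: sparseS sp => //; lia.
have cZ1N : #|Z1| <= N := leq_trans (subset_leq_card sZ1) cXN.
have hF3 : hsparse (coincident inc2 Y0) Z1 (coin_bound (back_bound mu) mu).
  apply: (coincident_hsparse famP (family_singletons Y0) _ _ _ sp3 cZ1N).
  - move=> x y xZ /setDP[yX yZ]; rewrite disjoint_sym disjoints1 !inE negb_or.
    rewrite (contraNneq _ yZ) => [/=|->//]; apply/bigcupP => -[i].
    by rewrite inE => /andP[iK _]; apply/negP/K1X; rewrite ?sK3.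
  - move=> x y xZ _ /exists_inP[i iK /andP[/eqP zi yi]].
    apply: touchS (outT i y (sK3 i iK) yi) => //.
    by rewrite subsetU // (bigcup_sup i) ?orbT // inE iK zi eqxx.
  - move=> y /setDP[yX yZ]; apply: leq_trans (rkP y yX).
    apply/subset_leq_card/subsetP => x; rewrite !inE => /andP[xZ].
    case/exists_inP => i iK /andP[/eqP zi yi]; have [zo zmin] := zP i iK.
    have xy : y != x by apply: contraNneq yZ => ->.
    rewrite sZ1' //= /F2 /coincident xy /=; apply/andP; split.
      by apply/exists_inP; exists i; rewrite // yi -zi.
    rewrite ltn_neqAle -{2}zi zmin // andbT; apply: contraNneq xy => /rkI ->//.
    exact: sZ1'.
have [Z2 [sZ2 ind2 cZ2]] := indep_weight w (coincident_sym _ _)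
  (coincident_irrefl _ _) hF3.
exists [set i in K3 | z i \in Z2], z; split.
- by apply/subsetP => i; rewrite inE => /andP[/sK3/(subsetP sK1)].
- have cw : #|K3| = \sum_(x in X) w x.
    rewrite sum_fibres; apply: eq_card => i; rewrite inE andb_idr //; exact: zX.
  have := leq_trans cZ1 (leq_mul (leqnn _) cZ2); rewrite -cw [in X in _ <= X]sum_fibres.
  rewrite /loss; move: (back_bound _) (coin_bound _ _) => b c le.
  apply: leq_trans cJ _; rewrite -[X in _ <= X]mulnA leq_mul2l; apply/orP; right.
  apply: leq_trans cK2 (leq_trans (leq_mul (leqnn 2) cK3) _).
  by rewrite mulnA -!(mulnA 4) leq_mul2l -mulnA.
- by move=> i; rewrite inE => /andP[/zP[]]; rewrite inE => /andP[].
- move=> i j /setIdP[/zX zi _] /setIdP[/sK3 jK _] _.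
  exact: K1X.
move=> i j /setIdP[iK zi] /setIdP[jK zj] zij.
have ij : i != j by apply: contraNneq zij => ->.
apply/pred0P => y; apply/negP => /andP[yi yj].
have {yi yj} [yi yj] := common i j y (sK3 i iK) (sK3 j jK) ij yi yj.
have [yX sZ2'] := (outX i y yi, subsetP sZ2).
have [yZ|yZ] := boolP (y \in Z1).
  have link k : k \in K3 -> z k \in Z2 -> y \in out k -> y = z k.
    move=> kK zk yk; apply/eqP; apply: contraT => ne.
    have := ind1 y (z k) yZ (sZ2' _ zk); rewrite /F2 /coincident ne /= => /exists_inP[].
    by exists k => //; rewrite yk /=; case: (zP k kK).
  by rewrite -(link i iK zi yi) -(link j jK zj yj) eqxx in zij.
have := ind2 (z i) (z j) zi zj; rewrite /coincident zij /= => /exists_inP[].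
exists y; first by rewrite inE yZ.
by apply/andP; split; apply/exists_inP; [exists i|exists j]; rewrite // eqxx.
Qed.

End Stage.

(** * Scattered subsets of [B] and the deletion of hubs *)

Section Core.
Variables (T : finType) (e : rel T).
Hypothesis es : symmetric e.
Implicit Types (S B J : {set T}) (Q P : T -> {set T}).

(** Vertices of [S] stay present but become isolated, which keeps the vertex type fixed. *)
Definition avoiding S : rel T := fun x y => [&& e x y, x \notin S & y \notin S].

Lemma avoiding_sym S : symmetric (avoiding S).
Proof. by move=> x y; rewrite /avoiding es [(x \notin S) && _]andbC. Qed.

Lemma avoiding_sub S : subrel (avoiding S) e.
Proof. by move=> x y /and3P[]. Qed.

Lemma avoidingS S S' : S \subset S' -> subrel (avoiding S') (avoiding S).
Proof.
move=> /subsetP sS x y /and3P[exy xS yS]; rewrite /avoiding exy.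
by rewrite !(contra (sS _)).
Qed.

Lemma avoiding_family S r J Q : {in J, forall j, [disjoint Q j & S]} ->
  family e r J Q -> family (avoiding S) r J Q.
Proof.
move=> dS [rQ dQ]; split=> // j jJ; have [c cj sub] := rQ j jJ; exists c => //.
apply: subset_trans sub _; apply: ballS => // x y /and3P[exy xj yj].
by rewrite /within /avoiding exy xj yj !(disjointFr (dS j jJ)).
Qed.

Lemma nb_avoiding_disjoint S (X : {set T}) : [disjoint X & S] ->
  [disjoint nb (avoiding S) X & S].
Proof.
move=> dX; apply/pred0P => x /=; apply/negP => /andP[/nbP[xX|[y _ /and3P[_ _ xS]]] xS'].
  by rewrite (disjointFr dX xX) in xS'.
by rewrite xS' in xS.
Qed.

(** The invariant after [i] stages. The common lower bound [s] lets the product [s * #|J|] measure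
    how much of [B] survives. *)
Definition scattered B i r S J Q P s :=
  [/\ family e r J Q,
      {in J, forall j, [/\ [disjoint Q j & S], P j \subset B, s <= #|P j| &
         ball (avoiding S) i (P j) \subset Q j]},
      0 < s & s * #|J| <= #|B|].

(** Either the centre of a heavy cluster becomes a hub, or dyadically selected clusters become the
    new pieces. Of the exponents, 52 is the cost of [clusters] and 2 that of the dyadic
    selection. *)
Lemma scatter_step B i r S J Q P s mu a N L :
  scattered B i r S J Q P s -> sparse e (2 * r).+2 mu N ->
  mu.+1 * mu.+1 * #|B| <= N -> 1 < mu -> L.+1 <= mu -> #|B| < 2 ^ L.+1 ->
  mu ^ (a + 56) <= #|J| ->
  (exists z J', [/\ J' \subset J, z \notin S,
     {in J', forall j, z \notin Q j /\ touch e (Q j) [set z]} &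
     #|J| <= mu ^ (a + 55) * #|J'|]) \/
  (exists J' Q' P' s', [/\ scattered B i.+1 (2 * r).+2 S J' Q' P' s',
     mu ^ a <= #|J'| & s * #|J| <= mu ^ 54 * (s' * #|J'|)]).
Proof.
move=> [famJ JP s0 sJB] sp leN mu1 Lmu BL bigJ.
have mu0 : 0 < mu by lia.
have powmu n : 0 < mu ^ n by rewrite expn_gt0 mu0.
have J0 : 0 < #|J| := leq_trans (powmu _) bigJ.
have JB : #|J| <= #|B| by nia.
have dQS : {in J, forall j, [disjoint Q j & S]} by move=> j /JP[].
have famS := avoiding_family dQS famJ.
have spS : sparse (avoiding S) (2 * r).+2 mu N by apply: sparseS sp => //; exact: avoiding_sub.
have JN : mu.+1 * mu.+1 * #|J| <= N by nia.
have J0' : J != set0 by rewrite -card_gt0.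
have [K [lam [sK cJ lamQ lamQ' sep]]] := clusters (avoiding_sym S) mu0 famS spS JN J0'.
have {}cJ : #|J| <= mu ^ 52 * #|K|.
  by apply: leq_trans cJ _; rewrite leq_mul2r loss_le ?orbT.
have bigK : mu ^ (a + 4) <= #|K|.
  rewrite -(leq_pmul2l (powmu 52)) -expnD; apply: (leq_trans _ cJ).
  by apply: (leq_trans _ bigJ); rewrite leq_pexp2l //; lia.
have sK' j : j \in K -> j \in J by move/(subsetP sK).
pose C z := [set j in K | lam j == z].
have [/existsP[z heavy]|/existsPn light] :=
    boolP [exists z, #|K| <= mu ^ (a + 3) * #|C z|].
  left; exists z, (C z).
  (* A second member [k] is needed: the label of [k] is also [z], and [lamQ'] then keeps [z] out of
     [Q j]. *)
  have C2 : 1 < #|C z|.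
    have: mu ^ (a + 3) * mu <= mu ^ (a + 3) * #|C z|.
      by rewrite -expnSr -addnS (leq_trans bigK heavy).
    by rewrite leq_pmul2l // => /(leq_trans mu1).
  have zQ j : j \in C z -> z \notin Q j.
    move=> /setIdP[jK _].
    have [k] : exists k, k \in C z :\ j.
      apply/set0Pn; rewrite -card_gt0; move: C2; rewrite (cardsD1 j).
      by case: (j \in C z); lia.
    rewrite !inE => /and3P[kj kK /eqP <-]; exact: lamQ'.
  split.
  - by apply/subsetP => j /setIdP[/sK'].
  - have [j jC] : exists j, j \in C z by apply/set0Pn; rewrite -card_gt0; lia.
    have /setIdP[jK /eqP jz] := jC; have := lamQ j jK; rewrite jz => zn.
    by rewrite (disjointFr (nb_avoiding_disjoint (dQS j (sK' j jK))) zn).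
  - move=> j jC; split; first exact: zQ.
    have /setIdP[jK /eqP jz] := jC; have := lamQ j jK; rewrite jz.
    case/nbP => [zj|[y yj /avoiding_sub eyz]]; first by rewrite (negPf (zQ j jC)) in zj.
    by apply/touchP; exists y, z; rewrite inE.
  - apply: leq_trans cJ _; have -> : a + 55 = 52 + (a + 3) by lia.
    by rewrite expnD -mulnA leq_mul2l heavy orbT.
right; pose w z := #|C z|; pose Z := [set lam j | j in K].
have sumw : \sum_(z in Z) w z = #|K|.
  rewrite sum_fibres; apply: eq_card => j; rewrite inE andb_idr // => jK.
  by apply/imsetP; exists j.
have [|Z' [s' [sZ s'0 s'w cZ]]] := @dyadic T Z w L.
  move=> z /imsetP[j jK ->]; apply/andP; split.
    by rewrite card_gt0; apply/set0Pn; exists j; rewrite inE jK /=.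
  apply: leq_ltn_trans BL; apply: leq_trans JB; apply: subset_leq_card.
  by apply/subsetP => k /setIdP[/sK'].
rewrite sumw in cZ.
have {}cZ : #|K| <= mu ^ 2 * (s' * #|Z'|).
  apply: leq_trans cZ _; rewrite mulnA leq_mul2r expnS expn1 mulnC leq_mul ?orbT //.
(* Lightness gives [mu ^ (a + 3) * s' < #|K|], while the selected clusters satisfy
   [#|K| <= mu ^ 2 * (s' * #|Z'|)]. *)
have cZ' : mu ^ a <= #|Z'|.
  have [z zZ] : exists z, z \in Z'.
    apply/set0Pn; apply: contraTneq bigK => Z0; rewrite -ltnNge.
    by apply: leq_ltn_trans cZ _; rewrite Z0 cards0 !muln0.
  have := light z; rewrite -ltnNge => lt.
  have le : mu ^ (a + 3) * s' <= mu ^ 2 * (s' * #|Z'|).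
    apply: leq_trans cZ; apply: leq_trans (ltnW lt).
    by rewrite leq_mul2l s'w ?orbT.
  rewrite mulnC mulnCA leq_pmul2l // (_ : a + 3 = 2 + a.+1) in le; last by lia.
  rewrite expnD leq_pmul2l // in le; apply: leq_trans le.
  by rewrite leq_pexp2l.
exists Z', (fun z => \bigcup_(j in C z) nb (avoiding S) (Q j)),
  (fun z => \bigcup_(j in C z) P j), (s * s').
have CK z j : j \in C z -> j \in K by case/setIdP.
have Zn z : z \in Z' -> exists j, j \in C z.
  by move=> zZ; apply/set0Pn; rewrite -card_gt0 (leq_trans s'0) ?s'w.
split=> //; last first.
  rewrite -mulnA [mu ^ 54 * _]mulnCA leq_mul2l; apply/orP; right.
  apply: leq_trans cJ _; rewrite (expnD mu 52 2) -mulnA leq_mul2l.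
  by rewrite cZ orbT.
have PQ j : j \in J -> P j \subset Q j.
  by move=> /JP[_ _ _]; apply: subset_trans; exact: sub_ball.
split.
- split=> [z zZ|z y zZ yZ zy].
    apply: (@radS _ (avoiding S)) (leqnn _) _; first exact: avoiding_sub.
    apply: (rad_star (z := z)) (avoiding_sym S) (Zn z zZ) _ => j jC; split.
      by apply: (proj1 famS); apply: sK'; exact: CK jC.
    by have /setIdP[jK /eqP <-] := jC; exact: lamQ.
  apply/pred0P => x; apply/negP => /andP[/bigcupP[j jC xj] /bigcupP[k kC xk]].
  have [/setIdP[jK /eqP jz] /setIdP[kK /eqP ky]] := (jC, kC).
  have jk : lam j != lam k by rewrite jz ky.
  by have /pred0P/(_ x) := sep j k jK kK jk; rewrite /= xj xk.
- move=> z zZ; split.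
  + rewrite disjoint_sym; apply/bigcup_disjointP => j jC; rewrite disjoint_sym.
    by apply: nb_avoiding_disjoint; apply: dQS; apply: sK'; exact: CK jC.
  + by apply/bigcupsP => j /CK/sK'/JP[].
  + apply: leq_trans (sum_card_disjoint (K := C z) (P := P) _).
      apply: leq_trans (_ : \sum_(j in C z) s <= _).
        by rewrite sum_nat_const mulnC leq_mul2r s'w ?orbT.
      by apply: leq_sum => j /CK/sK'/JP[].
    move=> j k /CK/sK' jJ /CK/sK' kJ jk.
    by apply: disjointWl (PQ j jJ) (disjointWr (PQ k kJ) (proj2 famJ j k jJ kJ jk)).
  apply/subsetP => x /ballP[y /bigcupP[j jC yj] xy]; apply/bigcupP; exists j => //.
  have [_ _ _ /subsetP sub] := JP j (sK' j (CK _ _ jC)).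
  move: xy; rewrite -add1n ballD; apply/subsetP/nbS => //.
  by apply/subsetP => v vy; apply: sub; apply/ballP; exists y.
- by rewrite muln_gt0 s0.
- rewrite -mulnA; apply: leq_trans sJB; rewrite leq_mul2l; apply/orP; right.
  apply: leq_trans (subset_leq_card sK); rewrite -sumw.
  apply: leq_trans (_ : \sum_(z in Z') w z <= _).
    by rewrite mulnC -sum_nat_const; apply: leq_sum.
  by rewrite [X in _ <= X](big_setID Z') /= (setIidPr sZ) leq_addr.
Qed.

Lemma scatteredS B i r S S' J J' Q P s : scattered B i r S J Q P s ->
  J' \subset J -> S \subset S' -> {in J', forall j, [disjoint Q j & S']} ->
  scattered B i r S' J' Q P s.
Proof.
move=> [famJ JP s0 sJB] sJ sS dS'; split=> //.
- exact: familyS famJ.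
- move=> j jJ; have [_ PB sP sub] := JP j (subsetP sJ j jJ); split=> //.
    exact: dS'.
  by apply: subset_trans sub; apply: ballS => //; exact: avoidingS.
- by apply: leq_trans sJB; rewrite leq_mul2l subset_leq_card ?orbT.
Qed.

(** Each hub absorbs a piece of its own, matched by position in the enumerations; since every hub
    touches every piece, the resulting branch sets form a clique minor. *)
Lemma hubs_not_clique_free r t J Q (H : {set T}) :
  family e r J Q -> t <= #|H| <= #|J| ->
  {in H & J, forall z j, z \notin Q j /\ touch e (Q j) [set z]} ->
  ~ clique_free e (2 * r).+1 t.
Proof.
move=> [rQ dQ] /andP[tH HJ] hub cf.
pose f z := nth z (enum J) (index z (enum H)).
have lt_idx z : z \in H -> index z (enum H) < size (enum J).
  by move=> zH; rewrite -cardE (leq_trans _ HJ) // cardE index_mem mem_enum.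
have fJ z : z \in H -> f z \in J by move=> zH; rewrite -mem_enum mem_nth ?lt_idx.
have fI : {in H &, injective f}.
  move=> z y zH yH; rewrite /f (set_nth_default y) ?lt_idx // => /eqP.
  rewrite nth_uniq ?lt_idx ?enum_uniq // => /eqP E.
  by rewrite -(nth_index z (_ : z \in enum H)) ?mem_enum // E nth_index ?mem_enum.
pose W z := [set z] :|: \bigcup_(j in [set f z]) Q j.
have Wl z : [set z] \subset W z by exact: subsetUl.
have Wr z : Q (f z) \subset W z by rewrite /W big_set1 subsetUr.
apply: (cf _ H W) => //.
  split=> [z zH|z y zH yH zy].
    apply: (rad_union (r := 0)) => //; first exact: rad1.
    move=> j /set1P ->; split; first exact/rQ/fJ.
    by rewrite touch_sym //; case: (hub z (f z)); rewrite ?fJ.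
  rewrite /W !big_set1; apply/pred0P => x; apply/negP => /= /andP[].
  rewrite !inE => /orP[/eqP->|xz] /orP[xy|xy].
  - by rewrite xy in zy.
  - by have [] := hub z (f y) zH (fJ y yH); rewrite xy.
  - by rewrite (eqP xy) in xz; have [] := hub y (f z) yH (fJ z zH); rewrite xz.
  - have fzy : f z != f y by apply: contraNneq zy => /fI ->.
    by have /pred0P/(_ x) := dQ _ _ (fJ z zH) (fJ y yH) fzy; rewrite /= xz xy.
move=> z y zH yH _; rewrite touch_sym //.
have [_] := hub z (f y) zH (fJ y yH); exact: touchS.
Qed.

(* A graph with no [t]-clique minor cannot supply [t] hubs, so at most [t] vertices
   are deleted before the clusters are small enough to merge. *)
Lemma hub_loop t h B i r S J Q P s (H : {set T}) mu a N L :
  scattered B i r S J Q P s -> H \subset S -> #|H| + h = t ->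
  {in H & J, forall z j, touch e (Q j) [set z]} ->
  clique_free e (2 * r).+1 t -> sparse e (2 * r).+2 mu N ->
  mu.+1 * mu.+1 * #|B| <= N -> 1 < mu -> t <= mu -> L.+1 <= mu ->
  #|B| < 2 ^ L.+1 -> mu ^ ((a + 56) * h.+1) <= #|J| ->
  exists S' J' Q' P' s', [/\ scattered B i.+1 (2 * r).+2 S' J' Q' P' s',
    #|S'| <= #|S| + h, mu ^ a <= #|J'| &
    s * #|J| <= mu ^ ((a + 56) * h.+1) * (s' * #|J'|)].
Proof.
move=> sc sH cH hub cf sp leN mu1 tmu Lmu BL.
have powmu n : 0 < mu ^ n by rewrite expn_gt0 (ltnW mu1).
(* [h] counts the hubs still missing; at [h = 0] the set [H] has [t] hubs and yields the forbidden
   clique. *)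
elim: h S J H sc sH cH hub => [|h IH] S J H sc sH cH hub bigJ.
  case: (hubs_not_clique_free (r := r) (t := t) (J := J) (Q := Q) (H := H)) => //.
  - by case: sc.
  - rewrite -cH addn0 leqnn /=; apply: leq_trans bigJ; rewrite muln1.
    rewrite addn0 in cH; rewrite cH; apply: leq_trans tmu _.
    by rewrite -[X in X <= _]expn1 leq_pexp2l ?addnS // ltnW.
  - move=> z j zH jJ; split; last exact: hub.
    case: sc => _ /(_ j jJ)[dj _ _ _] _ _.
    by apply/negP => zj; have := disjointFr dj zj; rewrite (subsetP sH).
have bigJ0 : mu ^ (a + 56) <= #|J|.
  by apply: leq_trans bigJ; rewrite leq_pexp2l ?leq_pmulr // ltnW.
have [|] := scatter_step sc sp leN mu1 Lmu BL bigJ0; last first.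
  case=> J' [Q' [P' [s' [sc' cJ' le]]]]; exists S, J', Q', P', s'.
  split; rewrite ?leq_addr //; apply: leq_trans le _.
  rewrite leq_mul2r leq_pexp2l ?orbT //; first exact: ltnW.
  by rewrite mulnS; lia.
case=> z [J' [sJ zS zQ cJ]].
have dJ' : {in J', forall j, [disjoint Q j & z |: S]}.
  move=> j jJ; case: sc => _ /(_ j (subsetP sJ j jJ))[dj _ _ _] _ _.
  rewrite disjoint_sym; apply/pred0P => x; apply/negP => /= /andP[].
  case/setU1P => [->|xS xj]; last by have := disjointFr dj xj; rewrite xS.
  by have [/negPf->] := zQ j jJ.
have bigJ' : mu ^ ((a + 56) * h.+1) <= #|J'|.
  rewrite -(leq_pmul2l (powmu (a + 55))) -expnD; apply: (leq_trans _ cJ).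
  apply: (leq_trans _ bigJ); rewrite leq_pexp2l ?(ltnW mu1) //.
  by rewrite [X in _ <= X]mulnS leq_add2r leq_add2l.
have zH : z \notin H by apply: contra zS; exact: (subsetP sH).
have [|||||S' [J2 [Q' [P' [s' [sc' cS cJ' le]]]]]] := IH (z |: S) J' (z |: H).
- exact: scatteredS sc sJ (subsetUr _ _) dJ'.
- exact: setUS.
- by rewrite cardsU1 zH; lia.
- move=> y j /setU1P[->|yH] jJ; first by case: (zQ j jJ).
  by apply: hub => //; exact: (subsetP sJ).
- by [].
exists S', J2, Q', P', s'; split=> //.
  by apply: leq_trans cS _; rewrite cardsU1 zS; lia.
rewrite (_ : (a + 56) * h.+2 = (a + 55) + ((a + 56) * h.+1).+1); last by lia.
rewrite expnD -mulnA; apply: leq_trans (_ : mu ^ (a + 55) * (s * #|J'|) <= _).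
  by rewrite mulnCA leq_mul2l cJ orbT.
rewrite leq_mul2l; apply/orP; right; apply: leq_trans le _.
by rewrite leq_mul2r leq_pexp2l ?orbT // ltnW.
Qed.

Definition scatter_radius i := iter i (fun r => (2 * r).+2) 0.

(** Computed backwards: for [mu ^ a] pieces after the last stage, the earlier stages must leave
    [mu ^ ((a + 56) * t.+1)], which pays for up to [t] hub deletions and one merging. *)
Fixpoint scatter_exp t i a :=
  if i is i'.+1 then scatter_exp t i' ((a + 56) * t.+1) + (a + 56) * t.+1 else a.

Lemma scatter t R B mu N L i a :
  clique_free e R t -> sparse e R mu N -> scatter_radius i <= R ->
  mu.+1 * mu.+1 * #|B| <= N -> 1 < mu -> t <= mu -> L.+1 <= mu ->
  #|B| < 2 ^ L.+1 -> mu ^ scatter_exp t i a <= #|B| ->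
  exists S J Q P s, [/\ scattered B i (scatter_radius i) S J Q P s,
    #|S| <= i * t, mu ^ a <= #|J| &
    #|B| <= mu ^ scatter_exp t i a * (s * #|J|)].
Proof.
move=> cf sp + leN mu1 tmu Lmu BL; elim: i a => [|i IH] a leR bigB.
  exists set0, B, set1, set1, 1; split=> //; rewrite ?cards0 //.
    split; rewrite ?mul1n //; first exact: family_singletons.
    move=> x xB; split; [by rewrite -setI_eq0 setI0|by rewrite sub1set|by rewrite cards1|].
    exact: subxx.
  by rewrite mul1n leq_pmull // expn_gt0 (ltnW mu1).
have leR' : (2 * scatter_radius i).+2 <= R by [].
have [||S [J [Q [P [s [sc cS cJ le]]]]]] := IH ((a + 56) * t.+1).
- by apply: leq_trans leR'; lia.
- by apply: leq_trans bigB; rewrite leq_pexp2l ?leq_addr // ltnW.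
have [||||S' [J' [Q' [P' [s' [sc' cS' cJ' le']]]]]] :=
  @hub_loop t t B i _ S J Q P s set0 mu a N L sc (sub0set _) _ _ _ _ leN mu1 tmu Lmu BL cJ.
- by rewrite cards0.
- by move=> z j; rewrite inE.
- by apply: clique_freeS cf => //; exact: ltnW.
- exact: sparseS sp.
exists S', J', Q', P', s'; split=> //.
  by apply: leq_trans cS' _; rewrite mulSn addnC leq_add2l.
apply: leq_trans le _; rewrite /= expnD -mulnA leq_mul2l.
by rewrite le' orbT.
Qed.

End Core.

(** * From distances and depth-[r] minors of graphs to balls and families *)

Lemma dist_le_ball (G : sgraph) n (x y : G) :
  dist_le n x y = (y \in ball (@adj G) n [set x]).
Proof.
apply/dist_leP/idP => [[p [+ <-]]|].
  elim: p x n => [x n _ _|z p IH x [//|n] /andP[xz zp] sp].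
    by apply: (subsetP (sub_ball _ _ _)); rewrite inE.
  by rewrite -addn1; apply: ball_trans (ball1_edge xz) (IH z n zp sp).
elim: n y => [y /set1P->|n IH y /nbP[/IH[p [xp lp sp]]|[z /IH[p [xp lp sp]] zy]]].
- by exists [::].
- by exists p; split=> //; exact: leqW.
- by exists (rcons p y); rewrite rcons_path last_rcons size_rcons xp lp.
Qed.

Lemma dist_le_induced (G : sgraph) (X : {set G}) n (c : induced X) y :
  y \in ball (within (@adj G) X) n [set val c] ->
  exists2 v : induced X, val v = y & dist_le n c v.
Proof.
elim: n y => [y /set1P->|n IH y /nbP[/IH[v vy cv]|[z /IH[v vz cv] /and3P[zy zX yX]]]].
- by exists c => //; rewrite dist_le_ball inE.
- by exists v => //; move: cv; rewrite !dist_le_ball; apply/subsetP/sub_nb.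
- pose u : induced X := Sub y yX; exists u; first exact: SubK.
  move: cv; rewrite !dist_le_ball => cv; apply/nbP; right; exists v => //.
  by rewrite /adj /= /induced_adj vz SubK.
Qed.

Lemma rad_induced (G : sgraph) (X : {set G}) r : rad (@adj G) r X ->
  connected (induced X) /\ radius_le (induced X) r.
Proof.
move=> [c cX /subsetP sub]; pose c' : induced X := Sub c cX.
have near_c (v : induced X) : dist_le r c' v.
  have [|u uv] := @dist_le_induced G X r c' (val v); first by rewrite SubK sub ?(valP v).
  by move/val_inj: uv => ->.
have conn (v : induced X) : connect (@adj (induced X)) c' v.
  by have /dist_leP[p [cp <- _]] := near_c v; apply/connectP; exists p.
split=> [x y|].
  apply: connect_trans (conn y); rewrite (sym_connect_sym (@adj_sym _)); exact: conn.
pose cov s := [exists c : induced X, [forall v, dist_le s c v]].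
have covP s : cov s <-> covered_within (induced X) s.
  split=> [/existsP[a /forallP]|[a aP]]; first by exists a.
  by apply/existsP; exists a; apply/forallP.
have ex : exists s, cov s by exists r; apply/covP; exists c'.
case: (ex_minnP ex) => s /covP sP smin; exists s.
  by split=> // s' /covP/smin.
by apply: smin; apply/covP; exists c'.
Qed.

(** An excluded graph is a subgraph of every clique on at least as many vertices. Singletons of the
    uncovered vertices complete the branch sets to a partition. *)
Lemma nowhere_dense_clique_free C r : nowhere_dense C ->
  exists2 t, 0 < t & forall G : sgraph, C G -> clique_free (@adj G) r t.
Proof.
(* The successor keeps [J] nonempty even when [H] has no vertices, which supplies the default
   [i0]. *)
move=> /(_ r)[H HC]; exists #|H|.+1 => // G CG I J Q [rQ dQ] leJ tch.
apply: (HC G CG).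
pose U := \bigcup_(i in J) Q i.
pose P := [set Q i | i in J] :|: [set [set x] | x in ~: U].
have PP X : X \in P -> (exists2 i, i \in J & X = Q i) \/ (exists2 x, x \notin U & X = [set x]).
  case/setUP => /imsetP[x]; first by left; exists x.
  by rewrite inE; right; exists x.
have QP i : i \in J -> Q i \in P by move=> iJ; rewrite inE imset_f.
have Qn i : i \in J -> exists x, x \in Q i by move=> /rQ[c ci _]; exists c.
have QU i x : i \in J -> x \in Q i -> x \in U by move=> iJ xi; apply/bigcupP; exists i.
exists P; split.
- apply/and3P; split.
  + apply/eqP/setP => x; rewrite inE; apply/bigcupP.
    have [/bigcupP[i iJ xi]|xU] := boolP (x \in U); first by exists (Q i); rewrite ?QP.
    by exists [set x]; rewrite !inE // imset_f ?orbT // inE.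
  + apply/trivIsetP => X Y /PP[[i iJ ->]|[x xU ->]] /PP[[j jJ ->]|[y yU ->]] ne.
    * by apply: dQ => //; apply: contraNneq ne => ->.
    * by rewrite disjoint_sym disjoints1; apply: contra yU; exact: QU.
    * by rewrite disjoints1; apply: contra xU; exact: QU.
    * by rewrite disjoints1 inE; apply: contraNneq ne => ->.
  + apply/negP => /PP[[i /Qn[x xi] E]|[x _ E]].
      by rewrite -E inE in xi.
    by have := set11 x; rewrite -E inE.
- move=> X /PP[[i /rQ ri ->]|[x _ ->]]; first exact: rad_induced.
  by apply: rad_induced; exact: (radS (fun _ _ h => h) (leq0n r) (rad1 (@adj G) x)).
have lt_idx (h : H) : enum_rank h < size (enum J).
  by rewrite -cardE; apply: ltn_trans leJ; exact: ltn_ord.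
have [i0 i0J] : exists i, i \in J by apply/set0Pn; rewrite -card_gt0; exact: leq_trans leJ.
pose g (h : H) := nth i0 (enum J) (enum_rank h).
have gJ h : g h \in J by rewrite -mem_enum mem_nth.
have gI : injective g.
  move=> h h' /eqP; rewrite nth_uniq ?enum_uniq // => /eqP/val_inj.
  exact: enum_rank_inj.
pose f h : quotient_graph P := Sub (Q (g h)) (QP _ (gJ h)).
have fI : injective f.
  move=> h h' /(congr1 val); rewrite !SubK => E; apply/gI/eqP.
  apply: contraT => ne; have [x xh] := Qn _ (gJ h).
  by have /pred0P/(_ x) := dQ _ _ (gJ h) (gJ h') ne; rewrite /= -E xh.
exists f => // h h' hh'; have ne : h != h'.
  by apply: contraTneq hh' => ->; rewrite adj_irrefl.
rewrite /adj /= /quotient_adj (inj_eq fI) ne /=.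
by apply: tch; rewrite ?(inj_eq gI).
Qed.

(** * Extracting a homogeneous pair from a scattered family *)

Section Homogeneous.
Variables (T : finType) (e : rel T).
Implicit Types A B S J : {set T}.

(** A walk that meets [S] is cut at a vertex of [S]; the lengths of the two parts add up to at most
    [n]. *)
Lemma ball_avoid S n x y : y \in ball e n [set x] ->
  y \in ball (avoiding e S) n [set x] \/
  exists s m, [/\ s \in S, m <= n, s \in ball e m [set x] & y \in ball e (n - m) [set s]].
Proof.
have self k z : z \in ball e k [set z] by apply: (subsetP (sub_ball _ _ _)); rewrite inE.
elim: n y => [|n IH] y; first by left.
case/nbP => [/IH[yx|[s [m [sS mn xs sy]]]]|[z xz ezy]].
- by left; apply/nbP; left.
- right; exists s, m; split=> //; first exact: leqW.
  by rewrite subSn //; apply/nbP; left.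
have [zS|zS] := boolP (z \in S).
  by right; exists z, n; split=> //; rewrite subSnn; exact: ball1_edge.
have [yS|yS] := boolP (y \in S).
  right; exists y, n.+1; split; rewrite ?subnn //.
  by apply/nbP; right; exists z.
case: (IH z xz) => [xz'|[s [m [sS mn xs sz]]]].
  by left; apply/nbP; right; exists z; rewrite // /avoiding ezy zS.
right; exists s, m; split=> //; first exact: leqW.
by rewrite subSn //; apply/nbP; right; exists z.
Qed.

(* Outside [S] the pieces are out of reach of most of [A]; through [S], all vertices
   with the same distances to [S] are reached alike. *)
Lemma homogeneous_pair d r S J Q P s A B c : 
  scattered e B d r S J Q P s -> 0 < c -> 2 ^ (#|S| * d.+1) * (2 * c) <= #|J| ->
  exists A' B', [/\ A' \subset A, B' \subset B, [disjoint A' & B'],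
    c * #|A| <= c * #|A'| + #|A| &
    s * #|J| <= 2 ^ (#|S| * d.+1) * (4 * c) * #|B'| /\
    {in A' & B', forall a b, {in B', forall b',
       a \in ball e d [set b] -> a \in ball e d [set b']}}].
Proof.
move=> [[_ dQ] JP s0 sJB] c0 bigJ; set Pi := 2 ^ _ in bigJ *.
have Pi0 : 0 < Pi by rewrite expn_gt0.
have PQ j : j \in J -> P j \subset Q j.
  by move=> /JP[_ _ _]; apply: subset_trans; exact: sub_ball.
(* The sets are trimmed to exactly [s] elements, so that each weighs at most the target [v] passed
   to [light_subset]. *)
have /fin_all_exists[P' P'P] j : exists Y : {set T}, j \in J -> Y \subset P j /\ #|Y| = s.
  have [jJ|jJ] := boolP (j \in J); last by exists set0.
  have [_ _ sP _] := JP j jJ; have [Y sY cY] := subset_of_card sP.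
  by exists Y.
have P'Q j : j \in J -> P' j \subset Q j.
  by move=> jJ; apply: subset_trans (PQ j jJ); case: (P'P j jJ).
have dP' (F : T -> {set T}) (K : {set T}) : K \subset J ->
    {in J, forall j, F j \subset Q j} ->
    {in K &, forall i j, i != j -> [disjoint F i & F j]}.
  move=> /subsetP sK FQ i j /sK iJ /sK jJ ij.
  exact: disjointWl (FQ i iJ) (disjointWr (FQ j jJ) (dQ i j iJ jJ ij)).
pose B0 := \bigcup_(j in J) P' j.
have cB0 : s * #|J| <= #|B0|.
  apply: leq_trans (sum_card_disjoint (dP' P' J (subxx _) P'Q)).
  by rewrite mulnC -sum_nat_const; apply: leq_sum => j /P'P[_ ->].
have J0 : 0 < #|J| by apply: leq_trans bigJ; rewrite !muln_gt0 Pi0 c0.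
(* The profile records the distances from [b] to the vertices of [S], truncated beyond [d]; it takes
   at most [2 ^ (#|S| * d.+1)] values. *)
pose prof (b : T) := [set p : T * 'I_d.+1 | (p.1 \in S) && (p.1 \in ball e p.2 [set b])].
have [||w] := @pigeonhole _ _ prof B0 (powerset (setX S setT)).
- move=> b _; rewrite inE; apply/subsetP => p; rewrite !inE => /andP[-> _]//.
- by rewrite -card_gt0; apply: leq_trans cB0; rewrite muln_gt0 s0.
rewrite card_powerset cardsX cardsT card_ord -/Pi.
set B1 := [set b in B0 | _] => cB1.
pose F j := P' j :&: B1.
have FQ : {in J, forall j, F j \subset Q j}.
  by move=> j jJ; apply: subset_trans (subsetIl _ _) (P'Q j jJ).
have sumF : #|B1| <= \sum_(j in J) #|F j|.
  apply: leq_trans (leq_card_bigcup_sum _ _); apply/subset_leq_card/subsetP => b bB1.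
  have /setIdP[/bigcupP[j jJ bj] _] := bB1.
  by apply/bigcupP; exists j; rewrite // inE bj.
have sumA : \sum_(j in J) #|A :&: Q j| <= #|A|.
  apply: leq_trans (sum_card_disjoint (dP' _ J (subxx _) _)) _.
    by move=> j _; exact: subsetIr.
  by apply/subset_leq_card/bigcupsP => j _; exact: subsetIl.
have big1 : s * (2 * c) <= #|B1|.
  rewrite -(leq_pmul2l Pi0); apply: leq_trans cB1; apply: leq_trans cB0.
  by rewrite mulnCA leq_mul2l bigJ orbT.
(* The largest target that [light_subset] admits for the weight of [B1]; [big1] makes it at least
   [s]. *)
pose v := #|B1| %/ (2 * c).
have c20 : 0 < 2 * c by lia.
have sv : s <= v by rewrite /v leq_divRL.
have v0 : 0 < v := leq_trans s0 sv.
have [||K sK [vK aK]] := @light_subset T J (fun j => #|F j|) (fun j => #|A :&: Q j|) v c v0 c0.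
- move=> j jJ; apply: leq_trans sv; have [_ <-] := P'P j jJ.
  exact/subset_leq_card/subsetIl.
- apply: leq_trans sumF; rewrite -mulnA [v * c]mulnC mulnA mulnC; exact: leq_divM.
pose UQ := \bigcup_(j in K) Q j; pose B' := \bigcup_(j in K) F j.
have sK' j : j \in K -> j \in J by move/(subsetP sK).
exists (A :\: UQ), B'; split.
- exact: subsetDl.
- apply/bigcupsP => j /sK' jJ; apply: subset_trans (subsetIl _ _) _.
  have [_ PB _ _] := JP j jJ; apply: subset_trans PB; by case: (P'P j jJ).
- apply/pred0P => x; apply/negP => /andP[/setDP[_ /negP xU]] /bigcupP[j jK xj].
  by apply: xU; apply/bigcupP; exists j => //; exact: (subsetP (FQ j (sK' j jK))).
- have: #|A :&: UQ| <= \sum_(j in K) #|A :&: Q j|.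
    apply: leq_trans (leq_card_bigcup_sum _ _); apply/subset_leq_card/subsetP => x.
    case/setIP => xA /bigcupP[j jK xj]; apply/bigcupP; exists j => //.
    by rewrite inE xA.
  rewrite -(leq_pmul2l c0) => /leq_trans/(_ (leq_trans aK sumA)).
  by rewrite -{2}(cardsID UQ A); lia.
split.
  apply: leq_trans cB0 (leq_trans cB1 _); rewrite -mulnA leq_mul2l; apply/orP; right.
  have vB' : v <= #|B'|.
    by apply: leq_trans vK (sum_card_disjoint (dP' F K sK FQ)).
  have: #|B1| < v.+1 * (2 * c) by rewrite /v ltn_ceil.
  nia.
move=> a b /setDP[aA aU] /bigcupP[j jK /setIP[bj /setIdP[bB0 /eqP bw]]] b'.
case/bigcupP => j' j'K /setIP[_ /setIdP[_ /eqP b'w]] ab.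
(* A walk from [b] avoiding [S] would end in the removed part [UQ]; any other passes through some
   [x] in [S], which [b'] reaches equally fast by equality of profiles. *)
case: (ball_avoid S ab) => [ab'|[x [m [xS md bx xa]]]].
  case/negP: aU; apply/bigcupP; exists j => //.
  have [_ _ _ /subsetP sub] := JP j (sK' j jK); apply: sub; apply/ballP; exists b => //.
  by have [/subsetP sub _] := P'P j (sK' j jK); apply: sub.
have : (x, Ordinal (md : m < d.+1)) \in prof b by rewrite inE /= xS.
rewrite bw -b'w inE /= => /andP[_ b'x].
by have := ball_trans b'x xa; rewrite subnK.
Qed.

End Homogeneous.

(** * Numerical estimates and choice of parameters *)

Lemma sqr_le_exp2 n : 4 <= n -> n * n <= 2 ^ n.
Proof.
move=> /subnK <-; elim: (n - 4) => // k IH.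
by rewrite addSn expnS; nia.
Qed.

(** Ensures that a set of fewer than [mu.+1 ^ q] elements has binary logarithm below [mu], which
    bounds the number of dyadic classes. *)
Lemma exp_succ_le_exp2 q m : 2 ^ (2 * q + 4) <= m -> m.+1 ^ q <= 2 ^ m.
Proof.
move=> big; pose l := up_log 2 m.+1.
have l1 : m.+1 <= 2 ^ l by apply: up_logP.
have l2 : 2 ^ l.-1 <= m.
  rewrite -ltnS; have := up_log_gtn (isT : 1 < 2) (_ : 1 < m.+1).
  by rewrite /l; lia.
apply: leq_trans (_ : (2 ^ l) ^ q <= _).
  by case: q {big} => // q; rewrite leq_exp2r.
rewrite -expnM leq_exp2l //.
have ql : 2 * q + 4 < l.
  rewrite -(@ltn_exp2l 2) //; exact: leq_ltn_trans big l1.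
have := sqr_le_exp2 (_ : 4 <= l); have : 2 ^ l = 2 * 2 ^ l.-1 by rewrite -expnS prednK //; lia.
move: l2; move: (2 ^ l.-1) (2 ^ l) => x y; nia.
Qed.

(** The order of quantifiers matters: [w] is fixed before [q], so that with [#|A :|: B|] near
    [mu ^ q] the loss [mu ^ w.+1] is as small a power of it as desired. *)
Lemma nowhere_dense_pairs_large (C : graph_class) (d c : nat) : nowhere_dense C -> 0 < c ->
  exists w, forall q, exists M, forall (G : sgraph) (A B : {set G}) mu, C G ->
    M <= mu -> #|A :|: B| < mu.+1 ^ q -> mu ^ w <= #|B| ->
    exists A' B' : {set G}, [/\ A' \subset A, B' \subset B, [disjoint A' & B'],
      c * #|A| <= c * #|A'| + #|A| &
      #|B| <= mu ^ w.+1 * #|B'| /\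
      {in A' & B', forall a b, {in B', forall b', dist_le d a b -> dist_le d a b'}}].
Proof.
move=> ndC c0; pose r0 := scatter_radius d.
have [t t0 cf] := nowhere_dense_clique_free r0 ndC.
exists (scatter_exp t d 1) => q.
(* With [q.+2] contractions, [mu ^ q.+3] has to beat a constant times [N], and [N] is at most
   [(2 * mu) ^ q.+2]. *)
have [t' t'0 cf'] := nowhere_dense_clique_free (minor_depth q.+2 r0) ndC.
pose Pi := 2 ^ (d * t * d.+1) * (4 * c).
pose K := (70 * t') ^ (q.+3 * q.+4).
(* The summands serve, in order, the logarithm bound, [t <= mu], the number of pieces required by
   [homogeneous_pair], and sparsity together with [1 < mu]. *)
exists (2 ^ (2 * q + 4) + t + Pi + (K * 2 ^ q.+2).+2) => G A B mu CG bigmu small bigB.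
have es : symmetric (@adj G) by exact: adj_sym.
have Pi0 : 0 < Pi by rewrite /Pi !muln_gt0 expn_gt0 c0.
have mu1 : 1 < mu by lia.
have leB : #|B| <= #|A :|: B| by rewrite subset_leq_card ?subsetUr.
pose N := mu.+1 * mu.+1 * #|A :|: B|.
have leN : mu.+1 * mu.+1 * #|B| <= N by rewrite leq_mul2l leB orbT.
have sp : sparse (@adj G) r0 mu N.
  apply: (clique_free_sparse es t'0 (cf' G CG)).
  have : N <= (2 * mu) ^ q.+2.
    apply: leq_trans (_ : mu.+1 ^ q.+2 <= _).
      by rewrite /N !expnS mulnA leq_mul2l (ltnW small) orbT.
    by rewrite leq_exp2r //; lia.
  rewrite -/K => le; apply: leq_ltn_trans (leq_mul (leqnn K) le) _.
  rewrite expnMn mulnA [X in _ < X]expnS ltn_mul2r expn_gt0 (ltnW mu1) /=; lia.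
have BL : #|B| < 2 ^ mu.-1.+1.
  rewrite prednK ?(ltnW mu1) //; apply: leq_ltn_trans leB (leq_trans small _).
  by apply: exp_succ_le_exp2; lia.
have Lmu : mu.-1.+1 <= mu by lia.
have tmu : t <= mu by lia.
have [S [J [Q [P [s [sc cS cJ le]]]]]] :=
  scatter es (cf G CG) sp (leqnn _) leN mu1 tmu Lmu BL bigB.
have lePi : 2 ^ (#|S| * d.+1) * (4 * c) <= Pi.
  by rewrite /Pi leq_mul2r leq_pexp2l ?orbT // leq_mul2r cS orbT.
have bigJ : 2 ^ (#|S| * d.+1) * (2 * c) <= #|J|.
  apply: (leq_trans _ cJ); rewrite expn1; apply: leq_trans (_ : Pi <= mu); last by lia.
  by apply: leq_trans lePi; rewrite leq_mul2l; apply/orP; right; lia.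
have [A' [B' [sA sB dAB cA [cB hom]]]] := homogeneous_pair A sc c0 bigJ.
exists A', B'; split=> //; split.
  apply: leq_trans le _; rewrite expnSr -mulnA leq_mul2l; apply/orP; right.
  apply: leq_trans cB _; rewrite leq_mul2r; apply/orP; right.
  by apply: leq_trans lePi _; lia.
move=> a b aA bB b' b'B; rewrite 2!(dist_le_sym _ a) !dist_le_ball.
exact: hom.
Qed.

(** When [B] has fewer than [mu ^ w] elements, a single vertex of it suffices as [B']; then [A] is
    so large that removing this vertex is affordable. *)
Lemma nowhere_dense_pairs (C : graph_class) (d c : nat) : nowhere_dense C -> 0 < c ->
  exists w, forall q, w < q -> exists M, forall (G : sgraph) (A B : {set G}) mu, C G ->
    M <= mu -> mu ^ q <= #|A :|: B| < mu.+1 ^ q ->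
    exists A' B' : {set G}, [/\ A' \subset A, B' \subset B, [disjoint A' & B'],
      c * #|A| <= c * #|A'| + #|A| &
      #|B| <= mu ^ w.+1 * #|B'| /\
      {in A' & B', forall a b, {in B', forall b', dist_le d a b -> dist_le d a b'}}].
Proof.
move=> ndC c0; have [w wP] := nowhere_dense_pairs_large d ndC c0; exists w => q wq.
have [M MP] := wP q; exists (M + c.+2) => G A B mu CG bigmu /andP[big small].
have [bigB|smallB] := leqP (mu ^ w) #|B|.
  by apply: (MP G A B mu) => //; lia.
have powmu n : 0 < mu ^ n by rewrite expn_gt0; lia.
have [->|[b bB]] := set_0Vmem B.
  exists A, set0; split; rewrite ?sub0set ?leq_addr //.
    by rewrite disjoint_sym -setI_eq0 set0I.
  by split; [rewrite cards0|move=> a b' _; rewrite inE].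
exists (A :\ b), [set b]; split.
- exact: subsetDl.
- by rewrite sub1set.
- by rewrite disjoint_sym disjoints1 !inE eqxx.
- have cA : c <= #|A|.
    have := (leq_card_setU A B).1; have : mu ^ w.+1 <= mu ^ q by rewrite leq_pexp2l //; lia.
    by rewrite expnS; have := powmu w; nia.
  by rewrite (cardsD1 b A) in cA *; case: (b \in A) cA; nia.
split; last by move=> a _ _ /set1P-> _ /set1P->.
rewrite cards1 muln1; apply: leq_trans (ltnW smallB) _.
by rewrite leq_pexp2l //; lia.
Qed.

(** [mu] is the integer part of the [q]-th root of [k]. *)
Lemma root_bracket q k M : 0 < q -> M ^ q <= k ->
  exists2 mu, M <= mu & mu ^ q <= k < mu.+1 ^ q.
Proof.
move=> q0 Mk; have ex : exists mu, mu ^ q <= k by exists M.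
have bd mu : mu ^ q <= k -> mu <= k.
  apply: leq_trans; case: mu => // mu.
  by rewrite -[X in X <= _]expn1 leq_pexp2l.
case: (ex_maxnP ex bd) => mu le mumax; exists mu; first exact: mumax.
by rewrite le ltnNge; apply/negP => /mumax; rewrite ltnn.
Qed.

(** * Passage to real exponents *)

Import Order.TTheory GRing.Theory Num.Theory.
Local Open Scope ring_scope.

Theorem theorem2 (R : realType) (C : graph_class) (hC : nowhere_dense C)
  (d : nat) (hd : (0 < d)%N) (eps : R) (heps : 0 < eps) :
  exists k0 : nat, forall (G : sgraph), C G -> forall (A B : {set G}),
    (k0 <= #|A :|: B|)%N ->
    exists (A' B' : {set G}),
      [/\ A' \subset A, B' \subset B & [disjoint A' & B']] /\
      [/\ #|A'|%:R >= (1 - eps) * #|A|%:R,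
          #|B'|%:R >= #|B|%:R / (#|A :|: B|%:R `^ eps)
        & forall a : G, a \in A' ->
            (forall b : G, b \in B' -> @adj (power_graph G d) a b) \/
            (forall b : G, b \in B' -> ~~ @adj (power_graph G d) a b)].
Proof.
(* An integer above [1 / eps]: losing a [1 / c] share of [A] is within the allowance. *)
pose c := Num.bound eps^-1.
have c_eps : 1 <= c%:R * eps.
  rewrite -ler_pdivrMr // div1r; apply/ltW; rewrite /c archi_boundP //.
  by rewrite invr_ge0 ltW.
have c0 : (0 < c)%N by case: (c) c_eps => //; rewrite mul0r ler10.
have [w wP] := nowhere_dense_pairs d hC c0.
(* Since [q * eps] is at least [w.+1], [mu ^ w.+1] is at most the [eps]-th power of [mu ^ q], hence
   of [k]. *)
pose q := (w.+1 * c)%N.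
have wq : (w < q)%N by rewrite /q leq_pmulr.
have [M MP] := wP q wq.
(* The successor makes [mu] positive as well as at least [M]. *)
exists (M.+1 ^ q)%N => G CG A B bigk; set k := #|A :|: B| in bigk *.
have [mu bigmu muk] := root_bracket (leq_ltn_trans (leq0n w) wq) bigk.
have [A' [B' [sA sB dAB cA [cB hom]]]] := MP G A B mu CG (ltnW bigmu) muk.
exists A', B'; split=> //; split.
- have : (c%:R * #|A|%:R : R) <= c%:R * #|A'|%:R + #|A|%:R.
    by rewrite -!natrM -natrD ler_nat.
  rewrite -lerBlDr => le; rewrite -(ler_pM2l (_ : 0 < c%:R)) ?ltr0n //.
  apply: le_trans le; rewrite mulrA mulrBr mulr1 mulrBl lerB //.
  by rewrite -{1}[_%:R]mul1r ler_wpM2r.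
- have mu0 : (0 < mu)%N by apply: leq_trans bigmu.
  have k0 : (0 < k)%N by apply: leq_trans bigk; rewrite expn_gt0.
  rewrite ler_pdivrMr ?powR_gt0 ?ltr0n // mulrC.
  apply: le_trans (_ : (mu ^ w.+1 * #|B'|)%:R <= _); first by rewrite ler_nat.
  rewrite natrM ler_wpM2r //.
  apply: le_trans (_ : (mu ^ q)%:R `^ eps <= _); last first.
    apply: ge0_ler_powR; rewrite ?nnegrE ?ler0n ?ler_nat //; first exact: ltW.
    by case/andP: muk.
  rewrite !natrX -!powR_mulrn // -powRrM ler_powR ?ler1n //.
  by rewrite /q natrM -mulrA ler_peMr.
(* One vertex of [B'] within distance [d] of [a] brings all of [B'] there; disjointness supplies the
   inequality demanded by adjacency in the power. *)
move=> a aA; have [/existsP[b /andP[bB ab]]|/existsPn none] :=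
  boolP [exists b, (b \in B') && dist_le d a b]; [left|right] => b' b'B.
- rewrite /= /power_adj (hom a b aA bB b' b'B ab) andbT.
  by apply: contraTneq aA => ->; rewrite (disjointFl dAB).
- rewrite /= /power_adj; have := none b'; rewrite b'B /= => /negPf ->.
  by rewrite andbF.
Qed.
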